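(* Let $G$ be a simply connected five dimensional nilpotent Lie group with a left invariant Riemannian metric $\tilde a$, whose Lie algebra $\mathfrak l_{5,6}$ has an $\tilde a$-orthonormal basis $\{E_1,\dots,E_5\}$ with non-zero brackets $[E_1,E_2]=aE_3+bE_4+cE_5$, $[E_1,E_3]=dE_4+fE_5$, $[E_1,E_4]=gE_5$, $[E_2,E_3]=hE_5$, where $a,d,g,h>0$ and either $b>0$, or $b=0$ and $f\ge0$. Let $F$ be a left invariant non-Riemannian Randers metric of Douglas type on $G$, induced by $\tilde a$ and a left invariant vector field $X=\lambda_1E_1+\lambda_2E_2$. Then the $S$-curvature of $F$ is given by $$S(Y)=3\left\{\frac{(y_1\lambda_2-y_2\lambda_1)(ay_3+by_4+cy_5)-\lambda_1y_3(dy_4+fy_5)-y_5(h\lambda_2y_3+g\lambda_1y_4)}{F(Y)}\right\},$$ where $Y=y_1E_1+y_2E_2+y_3E_3+y_4E_4+y_5E_5$ (non-zero).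
   Context: Brackets of basis elements not listed (and not obtained by antisymmetry) are zero. The Randers metric induced by $\tilde a$ and $X$, where $\sqrt{\tilde a(X,X)}<1$, is $F(x,y)=\sqrt{\tilde a(y,y)}+\tilde a(X(x),y)$. The spray coefficients of $F$ in standard local coordinates $(x,y)$ of the tangent bundle are $G^i=\frac14 g^{il}\big([F^2]_{x^my^l}y^m-[F^2]_{x^l}\big)$, where $g_{ij}=\frac12\frac{\partial^2F^2}{\partial y^i\partial y^j}$. $F$ is of Douglas type if in every standard local coordinate system $G^i=\frac12\Gamma^i_{jk}(x)y^jy^k+P(x,y)y^i$ for some functions $\Gamma^i_{jk}(x)$ and some local function $P(x,y)$ positively homogeneous of degree one in $y$. The $S$-curvature (Shen), with respect to the Busemann–Hausdorff volume form $\sigma(x)\,dx^1\cdots dx^n$, $\sigma(x)=\mathrm{Vol}(\text{unit ball of }\mathbb R^n)/\mathrm{Vol}\{(y^i)\in\mathbb R^n: F(x,y^i\partial_{x^i})<1\}$, is $S(x,y)=\frac{\partial G^m}{\partial y^m}(x,y)-y^m\frac{\partial\ln\sigma}{\partial x^m}(x)$; $S(Y)$ denotes $S(e,Y)$ and $F(Y)$ denotes $F(e,Y)$ for $Y$ in the Lie algebra $T_eG$. *)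

(* Defs.v *)
From HB Require Import structures.
From mathcomp Require Import all_boot all_order all_algebra.
From mathcomp Require Import all_classical all_reals all_analysis.

Set Implicit Arguments.
Unset Strict Implicit.
Unset Printing Implicit Defensive.

Import Order.TTheory GRing.Theory Num.Theory.
Import numFieldNormedType.Exports.

Local Open Scope classical_set_scope.
Local Open Scope ring_scope.

(** * Calculus on R^n *)

Definition pderiv (R : realType) (n : nat) (i : 'I_n) (f : 'rV[R]_n -> R)
    (x : 'rV[R]_n) : R :=
  'D_(delta_mx 0 i) f x.

(* Meant for open [U]. *)
Fixpoint Ck (R : realType) (n : nat) (k : nat) (U : set 'rV[R]_n)
    (f : 'rV[R]_n -> R) : Prop :=
  (forall x, U x -> {for x, continuous f}) /\
  match k with
  | 0 => True
  | k'.+1 => forall i : 'I_n,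
      (forall x, U x -> derivable f x (delta_mx 0 i)) /\
      Ck k' U (pderiv i f)
  end.

Definition smooth_on (R : realType) (n : nat) (U : set 'rV[R]_n)
    (f : 'rV[R]_n -> R) : Prop :=
  forall k, Ck k U f.

Definition smooth_map_on (R : realType) (n p : nat) (U : set 'rV[R]_n)
    (f : 'rV[R]_n -> 'rV[R]_p) : Prop :=
  forall i, smooth_on U (fun x => f x 0 i).

(* Lebesgue measure of R^n as the n-fold product measure: the recursive
   clause is the value of the product measure [lebesgue_measure \x _].  It is
   only meaningful on measurable sets; below it is applied to open sets. *)
Fixpoint vol (R : realType) (n : nat) : set 'rV[R]_n -> \bar R :=
  match n return set 'rV[R]_n -> \bar R with
  | 0 => fun A => (\1_A 0)%:E
  | n'.+1 => fun A =>
      (\int[@lebesgue_measure R]_t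
         vol [set v : 'rV[R]_n' | A (row_mx (const_mx t : 'rV[R]_1) v)])%E
  end.

(** * Topological and group-theoretic preliminaries *)

Definition simply_connected (R : realType) (T : topologicalType) : Prop :=
  (forall x y : T, exists p : R -> T,
     [/\ {within `[0, 1], continuous p}, p 0 = x & p 1 = y]) /\
  (forall p : R -> T, {within `[0, 1], continuous p} -> p 0 = p 1 ->
     exists H : R * R -> T,
       [/\ {within `[0, 1] `*` `[0, 1], continuous H},
           forall t : R, t \in `[0, 1] -> H (0, t) = p t,
           forall t : R, t \in `[0, 1] -> H (1, t) = p 0 &
           forall s : R, s \in `[0, 1] -> H (s, 0) = p 0 /\ H (s, 1) = p 0]).

(* No compatibility is assumed here, see [lie_group]. *)
HB.structure Definition GroupTopology := {G of Group G & Topological G}.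
Notation groupTopologyType := GroupTopology.type.

Definition is_subgroup (G : groupType) (H : set G) : Prop :=
  [/\ H 1%g, forall x y, H x -> H y -> H (x * y)%g &
      forall x, H x -> H x^-1%g].

Fixpoint lower_central (G : groupType) (k : nat) : set G :=
  match k with
  | 0 => setT
  | k'.+1 => smallest (@is_subgroup G)
      [set z | exists x y : G, lower_central k' x /\ z = [~ x, y]%g]
  end.

Definition nilpotent_group (G : groupType) : Prop :=
  exists k, lower_central k = [set 1%g : G].

(** * Smooth manifolds and Lie groups *)

(* [cmap] and [cinv] are only relevant on [cdom] and [cimg]. *)
Record chart (R : realType) (M : Type) (n : nat) := Chart {
  cdom : set M;
  cmap : M -> 'rV[R]_n;
  cinv : 'rV[R]_n -> M }.

Definition cimg (R : realType) (M : Type) (n : nat) (c : chart R M n) :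
    set 'rV[R]_n := cmap c @` cdom c.

Definition is_chart (R : realType) (M : topologicalType) (n : nat)
    (c : chart R M n) : Prop :=
  [/\ open (cdom c), open (cimg c),
      forall x, cdom c x -> cinv c (cmap c x) = x,
      forall x, cdom c x -> {for x, continuous (cmap c)} &
      forall u, cimg c u -> {for u, continuous (cinv c)}].

Definition compatible (R : realType) (M : Type) (n : nat)
    (c c' : chart R M n) : Prop :=
  smooth_map_on (cmap c @` (cdom c `&` cdom c')) (cmap c' \o cinv c).

(* [A] is the maximal atlas, i.e., the set of all local coordinate systems. *)
Definition smooth_manifold (R : realType) (M : topologicalType) (n : nat)
    (A : set (chart R M n)) : Prop :=
  [/\ hausdorff_space M, @second_countable M, A `<=` @is_chart R M n &
  [/\ forall x, exists2 c, A c & cdom c x,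
      forall c c', A c -> A c' -> compatible c c' &
      forall c, is_chart c ->
        (forall c', A c' -> compatible c c' /\ compatible c' c) -> A c]].

Definition lie_group (R : realType) (G : groupTopologyType) (n : nat)
    (A : set (chart R G n)) : Prop :=
  [/\ smooth_manifold A,
      continuous (fun p : G * G => (p.1 * p.2)%g),
      continuous (fun x : G => x^-1%g),
      forall c1 c2 c3, A c1 -> A c2 -> A c3 ->
        smooth_map_on
          [set w : 'rV[R]_(n + n) |
             [/\ cimg c1 (lsubmx w), cimg c2 (rsubmx w) &
                 cdom c3 (cinv c1 (lsubmx w) * cinv c2 (rsubmx w))%g]]
          (fun w => cmap c3 (cinv c1 (lsubmx w) * cinv c2 (rsubmx w))%g) &
      forall c1 c2, A c1 -> A c2 ->
        smooth_map_on [set u | cimg c1 u /\ cdom c2 (cinv c1 u)^-1%g]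
          (fun u => cmap c2 (cinv c1 u)^-1%g)].

(** * Tensor fields *)

(* Tensor fields and Finsler metrics on [M] are given by their components in
   each chart of the atlas.  [V c x] is the row of components of the vector
   V(x) with respect to the coordinate frame of [c], and [F c x y] is the
   value of F at the tangent vector at [x] whose components in [c] are [y].
   Values at [c], [x] with [x] outside of [cdom c] are irrelevant. *)

Notation vector_field R M n := (chart R M n -> M -> 'rV[R]_n).
Notation bilinear_field R M n := (chart R M n -> M -> 'M[R]_n).
Notation tangent_function R M n := (chart R M n -> M -> 'rV[R]_n -> R).

(* Differential at [x] of [f], from coordinates [c] to coordinates [c'];
   it acts on rows of components by right multiplication. *)
Definition diffm (R : realType) (M : Type) (n : nat) (f : M -> M)
    (c c' : chart R M n) (x : M) : 'M[R]_n :=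
  jacobian (cmap c' \o f \o cinv c) (cmap c x).

Definition is_vector_field (R : realType) (M : topologicalType) (n : nat)
    (A : set (chart R M n)) (V : vector_field R M n) : Prop :=
  (forall c c' x, A c -> A c' -> cdom c x -> cdom c' x ->
     V c' x = V c x *m diffm id c c' x) /\
  (forall c, A c -> smooth_map_on (cimg c) (fun u => V c (cinv c u))).

Definition field_eq (R : realType) (M : Type) (n : nat)
    (A : set (chart R M n)) (V W : vector_field R M n) : Prop :=
  forall c x, A c -> cdom c x -> V c x = W c x.

Definition bracket (R : realType) (M : Type) (n : nat)
    (V W : vector_field R M n) : vector_field R M n :=
  fun c x => \row_i \sum_j
    (V c x 0 j * pderiv j (fun u => W c (cinv c u) 0 i) (cmap c x)
     - W c x 0 j * pderiv j (fun u => V c (cinv c u) 0 i) (cmap c x)).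

Definition ip (R : realType) (M : Type) (n : nat) (m : bilinear_field R M n)
    (c : chart R M n) (x : M) (v w : 'rV[R]_n) : R :=
  (v *m m c x *m w^T) 0 0.

Definition is_riemannian_metric (R : realType) (M : topologicalType) (n : nat)
    (A : set (chart R M n)) (m : bilinear_field R M n) : Prop :=
  [/\ forall c c' x v w, A c -> A c' -> cdom c x -> cdom c' x ->
        ip m c' x (v *m diffm id c c' x) (w *m diffm id c c' x)
        = ip m c x v w,
      forall c x v w, A c -> cdom c x -> ip m c x v w = ip m c x w v,
      forall c x v, A c -> cdom c x -> v != 0 -> 0 < ip m c x v v &
      forall c, A c -> forall i j,
        smooth_on (cimg c) (fun u => m c (cinv c u) i j)].

(** * Left invariance *)

Definition left_invariant_field (R : realType) (G : groupTopologyType)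
    (n : nat) (A : set (chart R G n)) (V : vector_field R G n) : Prop :=
  forall (g x : G) c c', A c -> A c' -> cdom c x -> cdom c' (g * x)%g ->
    V c' (g * x)%g = V c x *m diffm (fun z => (g * z)%g) c c' x.

Definition left_invariant_metric (R : realType) (G : groupTopologyType)
    (n : nat) (A : set (chart R G n)) (m : bilinear_field R G n) : Prop :=
  forall (g x : G) c c' v w, A c -> A c' -> cdom c x -> cdom c' (g * x)%g ->
    ip m c' (g * x)%g (v *m diffm (fun z => (g * z)%g) c c' x)
                      (w *m diffm (fun z => (g * z)%g) c c' x)
    = ip m c x v w.

Definition left_invariant_finsler (R : realType) (G : groupTopologyType)
    (n : nat) (A : set (chart R G n)) (F : tangent_function R G n) : Prop :=
  forall (g x : G) c c' y, A c -> A c' -> cdom c x -> cdom c' (g * x)%g ->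
    F c' (g * x)%g (y *m diffm (fun z => (g * z)%g) c c' x) = F c x y.

(* Elements of the Lie algebra of [G], with Lie bracket [bracket]. *)
Definition in_lie_algebra (R : realType) (G : groupTopologyType)
    (n : nat) (A : set (chart R G n)) (V : vector_field R G n) : Prop :=
  is_vector_field A V /\ left_invariant_field A V.

Definition orthonormal_at (R : realType) (M : Type) (n p : nat)
    (A : set (chart R M n)) (m : bilinear_field R M n) (x : M)
    (E : p.-tuple (vector_field R M n)) : Prop :=
  forall c, A c -> cdom c x -> forall i j : 'I_p,
    ip m c x (tnth E i c x) (tnth E j c x) = (i == j)%:R.

(** * Randers metrics, sprays and S-curvature *)

Definition randers (R : realType) (M : Type) (n : nat)
    (m : bilinear_field R M n) (X : vector_field R M n) :
    tangent_function R M n :=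
  fun c x y => Num.sqrt (ip m c x y y) + ip m c x (X c x) y.

Definition is_riemannian (R : realType) (M : topologicalType) (n : nat)
    (A : set (chart R M n)) (F : tangent_function R M n) : Prop :=
  exists2 m, is_riemannian_metric A m &
    forall c x y, A c -> cdom c x -> F c x y = Num.sqrt (ip m c x y y).

(* Square of F in the local coordinates (u, y) of the tangent bundle. *)
Definition sqF (R : realType) (M : Type) (n : nat)
    (F : tangent_function R M n) (c : chart R M n) (u y : 'rV[R]_n) : R :=
  F c (cinv c u) y ^+ 2.

Definition fundamental_tensor (R : realType) (M : Type) (n : nat)
    (F : tangent_function R M n) (c : chart R M n) (u y : 'rV[R]_n) :
    'M[R]_n :=
  \matrix_(i, j) (2^-1 * pderiv i (pderiv j (sqF F c u)) y).

Definition spray (R : realType) (M : Type) (n : nat)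
    (F : tangent_function R M n) (c : chart R M n) (i : 'I_n)
    (u y : 'rV[R]_n) : R :=
  4^-1 * \sum_l invmx (fundamental_tensor F c u y) i l *
    ((\sum_k pderiv l (fun z => pderiv k (fun w => sqF F c w z) u) y * y 0 k)
     - pderiv l (fun w => sqF F c w y) u).

(* F is not smooth at the zero vectors, so the spray is only considered at
   y != 0. *)
Definition douglas (R : realType) (M : topologicalType) (n : nat)
    (A : set (chart R M n)) (F : tangent_function R M n) : Prop :=
  forall c, A c ->
    exists (Gam : 'I_n -> 'I_n -> 'I_n -> 'rV[R]_n -> R)
           (P : 'rV[R]_n -> 'rV[R]_n -> R),
      (forall u y (t : R), cimg c u -> y != 0 -> 0 < t ->
         P u (t *: y) = t * P u y) /\
      (forall i u y, cimg c u -> y != 0 ->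
         spray F c i u y =
         2^-1 * (\sum_j \sum_k Gam i j k u * y 0 j * y 0 k) + P u y * y 0 i).

(* Density of the Busemann-Hausdorff volume form. *)
Definition bh_density (R : realType) (M : Type) (n : nat)
    (F : tangent_function R M n) (c : chart R M n) (u : 'rV[R]_n) : R :=
  fine (vol [set y : 'rV[R]_n | \sum_i y 0 i ^+ 2 < 1]) /
  fine (vol [set y : 'rV[R]_n | F c (cinv c u) y < 1]).

Definition S_curvature (R : realType) (M : Type) (n : nat)
    (F : tangent_function R M n) (c : chart R M n) (x : M) (y : 'rV[R]_n) :
    R :=
  \sum_k pderiv k (spray F c k (cmap c x)) y
  - \sum_k y 0 k * pderiv k (fun u => ln (bh_density F c u)) (cmap c x).

(** * The Lie algebra l_{5,6} *)

Definition l56_brackets (R : realType) (M : Type) (n : nat)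
    (A : set (chart R M n)) (a b c d f g h : R)
    (E1 E2 E3 E4 E5 : vector_field R M n) : Prop :=
  [/\ field_eq A (bracket E1 E2) (a *: E3 + b *: E4 + c *: E5),
      field_eq A (bracket E1 E3) (d *: E4 + f *: E5),
      field_eq A (bracket E1 E4) (g *: E5),
      field_eq A (bracket E2 E3) (h *: E5) &
  [/\ field_eq A (bracket E1 E5) 0,
      field_eq A (bracket E2 E4) 0,
      field_eq A (bracket E2 E5) 0 &
  [/\ field_eq A (bracket E3 E4) 0,
      field_eq A (bracket E3 E5) 0 &
      field_eq A (bracket E4 E5) 0]]].

(* Main.v *)
Require Import Defs.
From HB Require Import structures.
From mathcomp Require Import all_boot all_order all_algebra.
From mathcomp Require Import all_classical all_reals all_analysis.
From mathcomp Require Import perm measurable_realfun ring lra.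
Import Order.TTheory GRing.Theory Num.Theory.
Import numFieldNormedType.Exports.
Local Open Scope classical_set_scope.
Local Open Scope ring_scope.

Set Implicit Arguments.
Unset Strict Implicit.
Unset Printing Implicit Defensive.

(** Write F = alpha + beta, where alpha is the Riemannian norm of the metric and
    beta the one-form dual to X.  Since X lies in the span of E1 and E2 while all
    brackets lie in the span of E3, E4, E5, the left invariant form beta
    vanishes on brackets, that is, beta is closed.

    For a closed form the spray of a Randers metric is a projective change of
    the Riemannian one: G = G_alpha + P y with P = r00 / (2 F), where
    r00(y) = (nabla_y beta)(y).  To see it, put G = G_alpha + P y in the
    equation 4 g G = [F^2]_{x^m y} y^m - [F^2]_x that defines the spray; the
    fundamental tensor g is invertible because its kernel is orthogonal to the
    differential of F and proportional to y (lemmas [randers_spray_eq],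
    [randers_hess_unitmx], [spray_randers]).  Taking the divergence in y, the
    Riemannian part contributes the derivative of ln sqrt det a along y, and
    P y contributes (n + 1) P by Euler's formula, P being homogeneous of
    degree one.

    On the other hand, in a left invariant orthonormal frame the indicatrix
    {F < 1} is a fixed body, an off-centre ellipsoid, so in coordinates its
    volume is a constant divided by sqrt det a ([frame_density]).  The
    logarithmic derivative of the Busemann-Hausdorff density therefore cancels
    the Riemannian divergence and S = (n + 1) r00 / (2 F)
    ([S_curvature_randers]).  The volume of an ellipsoid is computed by slicing:
    by Schur complements a slice of an ellipsoid is an ellipsoid of one
    dimension less ([vol_ellipsoid]).

    Finally r00(Y) = <[Y, X], Y> when Y is extended as a left invariant field
    ([frame_r00]), because <Y, Y> is constant and beta takes constant values on
    the frame.  With n = 5 and the structure constants of the algebra this is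
    the announced formula. *)

(** * Directional derivatives *)

Section DirectionalCalculus.
Context (R : realType) (V : normedModType R).
Implicit Types (f g : V -> R) (x v : V).

(** The rules for derivatives of sums and products are restated for functions
    given as abstractions, the form in which coordinate expressions occur. *)
Lemma is_derive_cstfun (k : R) x v : is_derive x v (fun=> k) 0.
Proof. exact: is_derive_cst. Qed.

Lemma is_derive_addfun f g x v df dg :
  is_derive x v f df -> is_derive x v g dg ->
  is_derive x v (fun z => f z + g z) (df + dg).
Proof. exact: is_deriveD. Qed.

Lemma is_derive_mulfun f g x v df dg :
  is_derive x v f df -> is_derive x v g dg ->
  is_derive x v (fun z => f z * g z) (df * g x + f x * dg).
Proof.
move=> Hf Hg; apply: (is_derive_eq (is_deriveM Hf Hg)).
by rewrite addrC /GRing.scale /= [df * _]mulrC.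
Qed.

Lemma is_derive_sumfun (I : Type) (r : seq I) (P : pred I) (f : I -> V -> R)
    x v (df : I -> R) :
  (forall i, is_derive x v (f i) (df i)) ->
  is_derive x v (fun z => \sum_(i <- r | P i) f i z) (\sum_(i <- r | P i) df i).
Proof.
move=> H; elim: r => [|i r IH].
  under [X in is_derive _ _ X _]eq_fun do rewrite big_nil.
  by rewrite big_nil; exact: is_derive_cstfun.
under [X in is_derive _ _ X _]eq_fun do rewrite big_cons.
by rewrite big_cons; case: ifP => // _; exact: is_derive_addfun.
Qed.

Lemma is_derive_prodfun (n : nat) (f : 'I_n -> V -> R) x v (df : 'I_n -> R) :
  (forall i, is_derive x v (f i) (df i)) ->
  is_derive x v (fun z => \prod_i f i z)
    (\sum_i df i * \prod_(j | j != i) f j x).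
Proof.
elim: n f df => [|n IH] f df H.
  under [X in is_derive _ _ X _]eq_fun do rewrite big_ord0.
  by rewrite big_ord0; exact: is_derive_cstfun.
under [X in is_derive _ _ X _]eq_fun do rewrite big_ord_recl.
have IHl := IH _ _ (fun i => H (lift ord0 i)).
apply: (is_derive_eq (is_derive_mulfun (H ord0) IHl)).
rewrite [RHS]big_ord_recl; congr (_ * _ + _).
  by rewrite [RHS]big_mkcond big_ord_recl /= mul1r.
rewrite mulr_sumr; apply: eq_bigr => i _.
rewrite mulrCA; congr (_ * _).
rewrite [RHS]big_mkcond big_ord_recl /=; congr (_ * _).
by rewrite big_mkcond; apply: eq_bigr => j _; rewrite (inj_eq lift_inj).
Qed.

(** A directional derivative is a derivative on the real line; this gives the
    chain rule with an outer function of one variable although the inner one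
    is only assumed to have a derivative along [v]. *)
Lemma is_derive_line f x v df :
  is_derive x v f df <-> is_derive (0 : R) 1 (fun h : R => f (h *: v + x)) df.
Proof.
have E : 'D_1 (fun h : R => f (h *: v + x)) 0 = 'D_v f x.
  rewrite /derive; set p := fun h : R => h^-1 *: _; set q := fun h : R => h^-1 *: _.
  rewrite (_ : p = q) //; apply/funext => h.
  by rewrite /p /q /= addr0 scale0r add0r [_%:A]mulr1.
split=> -[d e].
  by apply: DeriveDef; [exact: (derivable1P f x v).1|rewrite E].
by apply: DeriveDef; [exact: (derivable1P f x v).2|rewrite -E].
Qed.

Lemma is_derive_compfun (g : R -> R) f x v dg df :
  is_derive x v f df -> is_derive (f x) 1 g dg ->
  is_derive x v (fun z => g (f z)) (dg * df).
Proof.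
move=> /is_derive_line Hf Hg; apply/is_derive_line.
apply: is_derive1_comp.
by rewrite /= scale0r add0r.
Qed.

Lemma is_derive_sqrtfun f x v df : 0 < f x -> is_derive x v f df ->
  is_derive x v (fun z => Num.sqrt (f z)) (df / (2 * Num.sqrt (f x))).
Proof.
by move=> f0 Hf; rewrite mulrC; apply: is_derive_compfun => //; exact: is_derive1_sqrt.
Qed.

Lemma is_derive_invfun f x v df : f x != 0 -> is_derive x v f df ->
  is_derive x v (fun z => (f z)^-1) (- df / f x ^+ 2).
Proof.
move=> f0 Hf.
have Hinv := is_deriveV (f := id) f0 (is_derive_id (f x) (1 : R)).
apply: (is_derive_eq (is_derive_compfun Hf Hinv)).
by rewrite /GRing.scale /= mulr1 mulNr mulrC mulNr.
Qed.

(** Jacobi's formula.  Differentiating the Leibniz expansion row by row gives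
    the determinants in which one row of [M] is replaced by the row of [dM];
    expanding each along that row produces the cofactors. *)
Lemma is_derive_det (n : nat) (M : V -> 'M[R]_n) x v (dM : 'M[R]_n) :
  (forall i j, is_derive x v (fun z => M z i j) (dM i j)) ->
  is_derive x v (fun z => \det (M z)) (\tr (dM *m \adj (M x))).
Proof.
move=> H.
have Hs (s : {perm 'I_n}) := is_derive_mulfun (is_derive_cstfun ((-1) ^+ s) x v)
  (is_derive_prodfun (fun i => H i (s i))).
apply: (is_derive_eq (is_derive_sumfun _ _ Hs)).
under eq_bigr do rewrite mul0r add0r mulr_sumr.
rewrite exchange_big; apply: eq_bigr => i _ /=.
pose N : 'M[R]_n := \matrix_(k, l) if k == i then dM k l else M x k l.
transitivity (\det N).
  apply: eq_bigr => s _; congr (_ * _).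
  rewrite [RHS](bigD1 i) //= mxE eqxx; congr (_ * _).
  by apply: eq_bigr => j /negPf ji; rewrite mxE ji.
rewrite (expand_det_row _ i) mxE; apply: eq_bigr => j _.
rewrite !mxE eqxx; congr (_ * (_ * \det _)).
by apply/matrixP => k l; rewrite !mxE eq_sym (negPf (neq_lift i k)).
Qed.

End DirectionalCalculus.

Lemma is_derive_coord (R : realType) (n : nat) (x v : 'rV[R]_n) (i : 'I_n) :
  is_derive x v (fun z : 'rV[R]_n => z 0 i) (v 0 i).
Proof.
apply/is_derive_line.
under [X in is_derive _ _ X _]eq_fun do rewrite !mxE.
apply: (is_derive_eq (is_derive_addfun
  (is_derive_mulfun (is_derive_id _ _) (is_derive_cstfun (v 0 i) _ _))
  (is_derive_cstfun (x 0 i) _ _))).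
by rewrite mulr0 !addr0 mul1r.
Qed.

(** * Volumes of ellipsoids *)

Lemma ge0_integral_affine (R : realType) (G : R -> R) (p s : R) :
  0 < s -> continuous G -> (forall x, 0 <= G x) ->
  (\int[lebesgue_measure]_t (G t)%:E =
   s%:E * \int[lebesgue_measure]_x (G (p + s * x))%:E)%E.
Proof.
move=> s0 cG G0.
pose H (x : R) := p + s * x.
have dH (x : R) : is_derive x 1 H s.
  apply: (is_derive_eq (is_derive_addfun (is_derive_cstfun p x 1)
    (is_derive_mulfun (is_derive_cstfun s x 1) (is_derive_id x 1)))).
  by rewrite mul0r !add0r mulr1.
have H'E : (H^`())%classic = cst s :> (R -> R).
  by apply/funext => x; rewrite derive1E derive_val.
have mH : {homo H : x y / x < y} by move=> x y xy; rewrite ltrD2l ltr_pM2l.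
have HNy : H x @[x --> -oo] --> -oo.
  apply: (@cvg_comp _ _ _ (fun x => s * x) (fun x => p + x) _ -oo).
    exact: gt0_cvgMrNy cvg_id.
  exact: cvg_addrl_Ny.
have Hy : H x @[x --> +oo] --> +oo.
  apply: (@cvg_comp _ _ _ (fun x => s * x) (fun x => p + x) _ +oo).
    exact: gt0_cvgMry cvg_id.
  exact: cvg_addrl.
rewrite (increasing_ge0_integration_by_substitutionT mH _ _ _ _ HNy Hy cG G0) ?H'E //;
  [|by move=> x; exact: cvg_cst|exact: is_cvg_cst|exact: is_cvg_cst].
rewrite -ge0_integralZl_EFin ?ltW //.
- by apply: eq_integral => x _; rewrite -EFinM /= mulrC.
- by move=> x _; rewrite lee_fin.
- apply/measurable_EFinP; apply: continuous_measurable_fun => x.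
  apply: (@continuous_comp _ _ _ H G); last exact: cG.
  exact/differentiable_continuous/derivable1_diffP/ex_derive.
Qed.

(** The volume of a ball of squared radius [r] is proportional to [r ^ (n / 2)]
    when [r > 0] and vanishes otherwise.  The indicator matters only in
    dimension 0, where the square root alone would give volume 1 to the empty
    set. *)
Definition halfpow (R : realType) (n : nat) (r : R) : R :=
  (0 < r)%R%:R * Num.sqrt r ^+ n.

Lemma halfpow_le0 (R : realType) (n : nat) (r : R) : r <= 0 -> halfpow n r = 0.
Proof. by move=> r0; rewrite /halfpow ltNge r0 mul0r. Qed.

Lemma halfpowS (R : realType) (n : nat) (r : R) :
  halfpow n.+1 r = Num.sqrt r ^+ n.+1.
Proof.
rewrite /halfpow; case: ltP => [_|r0]; first by rewrite mul1r.
by rewrite mul0r (ler0_sqrtr r0) expr0n.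
Qed.

Lemma continuous_halfpowS_cap (R : realType) (n : nat) (r e p : R) :
  continuous (fun t : R => halfpow n.+1 (r - e * (t - p) ^+ 2)).
Proof.
under eq_fun do rewrite halfpowS expr2.
move=> t; apply: (@continuous_comp _ _ _
  (fun t => Num.sqrt (r - e * ((t - p) * (t - p)))) (fun x => x ^+ n.+1));
  last exact: exprn_continuous.
apply: (@continuous_comp _ _ _ (fun t => r - e * ((t - p) * (t - p))) Num.sqrt);
  last exact: sqrt_continuous.
apply: cvgB; first exact: cvg_cst.
apply: cvgM; first exact: cvg_cst.
by apply: cvgM; apply: cvgB; (exact: cvg_id || exact: cvg_cst).
Qed.

Lemma integral_indic_itv (R : realType) (x y : R) (b1 b2 : bool) : x < y ->
  (\int[lebesgue_measure]_t
     (\1_([set` Interval (BSide b1 x) (BSide b2 y)] : set R) t)%:E = (y - x)%:E)%E.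
Proof.
move=> xy; rewrite integral_indic //= setIT.
by rewrite lebesgue_measure_itv /= lte_fin xy EFinB.
Qed.

(** The constant is the value of a beta integral.  Only its being positive and
    finite is of interest; both follow by comparing the integrand with
    multiples of the indicators of [[-1/2, 1/2]] and [[-1, 1]]. *)
Lemma cap_integral_unit (R : realType) (n : nat) :
  exists2 k : R, 0 < k &
  (\int[lebesgue_measure]_t (halfpow n.+1 (1 - 1 * (t - 0) ^+ 2) : R)%:E = k%:E)%E.
Proof.
set f := fun t : R => halfpow n.+1 (1 - 1 * (t - 0) ^+ 2).
have f0 t : 0 <= f t by rewrite /f halfpowS exprn_ge0 ?sqrtr_ge0.
have mf : measurable_fun setT (EFin \o f).
  by apply/measurable_EFinP; apply: continuous_measurable_fun; exact: continuous_halfpowS_cap.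
have fle t : f t <= \1_(`[(-1 : R), 1] : set R) t.
  rewrite /f indicE mem_setE in_itv/= mul1r subr0.
  rewrite halfpowS.
  have [le|] := boolP (-1 <= t <= 1).
    rewrite exprn_ile1 ?sqrtr_ge0// -[leRHS]sqrtr1 ler_wsqrtr//.
    by have := sqr_ge0 t; lra.
  move=> out; rewrite ler0_sqrtr ?expr0n// subr_le0.
  move: out; rewrite -ler_norml -ltNge => /ltW out.
  by rewrite -real_normK ?num_real// exprn_ege1.
(* [q] is the value of [f] at the ends of [[-1/2, 1/2]], its minimum there *)
pose q : R := Num.sqrt (3 / 4) ^+ n.+1.
have q0 : 0 < q by rewrite exprn_gt0// sqrtr_gt0; lra.
have fge t : q * \1_(`[(- 2^-1 : R), 2^-1] : set R) t <= f t.
  rewrite indicE mem_setE in_itv/=.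
  have [le|_] := boolP (- 2^-1 <= t <= 2^-1); last by rewrite mulr0 f0.
  rewrite mulr1 /f halfpowS; apply: lerXn2r; rewrite ?nnegrE ?sqrtr_ge0 //.
  apply: ler_wsqrtr.
  have : t ^+ 2 <= 2^-1 ^+ 2 
    by rewrite -(real_normK (num_real t)) ler_sqr ?nnegrE ?invr_ge0 ?ler_norml //.
  lra.
have up : (\int[lebesgue_measure]_t (f t)%:E <= 2%:E)%E.
  apply: (@le_trans _ _ (\int[lebesgue_measure]_t (\1_(`[(-1 : R), 1] : set R) t)%:E)%E).
    apply: ge0_le_integral => //.
    - by move=> x _; rewrite lee_fin.
    - exact/measurable_EFinP/measurable_indic.
    - by move=> x _; rewrite lee_fin.
  by rewrite integral_indic_itv ?lee_fin; lra.
have mI : measurable_fun setT (\1_(`[(- 2^-1 : R), 2^-1] : set R) : R -> R).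
  exact: measurable_indic.
have lo : (q%:E <= \int[lebesgue_measure]_t (f t)%:E)%E.
  apply: (@le_trans _ _ (\int[lebesgue_measure]_t
                          (q * \1_(`[(- 2^-1 : R), 2^-1] : set R) t)%:E)%E).
    under eq_integral do rewrite EFinM.
    rewrite ge0_integralZl_EFin //; last 2 first.
    - exact/measurable_EFinP.
    - exact: ltW.
    rewrite integral_indic_itv; last by lra.
    by rewrite -EFinM lee_fin; lra.
  apply: ge0_le_integral => //.
  - by move=> x _; rewrite lee_fin mulr_ge0 // ltW.
  - by apply/measurable_EFinP; apply: measurable_funM.
  - by move=> x _; rewrite lee_fin.
move: up lo; case: (\int[lebesgue_measure]_t _)%E => [k| |] //.
by rewrite !lee_fin => _ qk; exists k => //; exact: (lt_le_trans q0).
Qed.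

(** Cavalieri's integral over the slices of an ellipsoid.  The substitution
    [t = p + x * sqrt (r / e)] takes it to the unit ball.  In the case [n = 0]
    the integrand is the indicator of an interval and not continuous, so that
    its length is computed directly. *)
Lemma cap_integral (R : realType) (n : nat) :
  exists2 k : R, 0 < k & forall r e p : R, 0 < e ->
  (\int[lebesgue_measure]_t (halfpow n (r - e * (t - p) ^+ 2))%:E =
   (k * halfpow n.+1 r / Num.sqrt e)%:E)%E.
Proof.
have [k k0 kP] : exists2 k : R, 0 < k & forall r e p : R, 0 < e -> 0 < r ->
  (\int[lebesgue_measure]_t (halfpow n (r - e * (t - p) ^+ 2))%:E =
   (k * halfpow n.+1 r / Num.sqrt e)%:E)%E; last first.
  exists k => // r e p e0; have [r0|r0] := ltP 0 r; first exact: kP.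
  rewrite (halfpow_le0 _ r0) mulr0 mul0r.
  apply: integral0_eq => t _; rewrite halfpow_le0 //.
  by rewrite subr_le0 (le_trans r0) // mulr_ge0 ?sqr_ge0 // ltW.
case: n => [|n].
  exists 2 => // r e p e0 r0.
  pose s := Num.sqrt (r / e).
  have s0 : 0 < s by rewrite sqrtr_gt0 divr_gt0.
  transitivity (\int[lebesgue_measure]_t (\1_(`]p - s, p + s[%classic : set R) t)%:E)%E.
    apply: eq_integral => t _; rewrite /halfpow expr0 mulr1 indicE mem_setE in_itv /=.
    congr (_%:R%:E); rewrite subr_gt0 mulrC -ltr_pdivlMr //.
    rewrite -(@sqr_sqrtr _ (r / e)) ?divr_ge0 ?ltW// -/s.
    rewrite -(real_normK (num_real (t - p))) ltr_sqr ?nnegrE ?(ltW s0) //.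
    by rewrite ltr_norml ltrBrDr ltrBlDr ![_ + p]addrC.
  rewrite integral_indic_itv; last by lra.
  rewrite halfpowS expr1 /s sqrtrM ?ltW// sqrtrV ?ltW//; congr EFin; ring.
have [k k0 kE] := cap_integral_unit R n.
exists k => // r e p e0 r0.
pose s := Num.sqrt r / Num.sqrt e.
have s0 : 0 < s by rewrite divr_gt0// sqrtr_gt0.
rewrite (@ge0_integral_affine _ _ p s) //; first last.
- by move=> x; rewrite halfpowS exprn_ge0 ?sqrtr_ge0.
- exact: continuous_halfpowS_cap.
under eq_integral => x _.
  rewrite (_ : _ - _ = r * (1 - 1 * (x - 0) ^+ 2)); last first.
    rewrite [p + _]addrC addrK exprMn expr_div_n !sqr_sqrtr ?(ltW r0) ?(ltW e0) //.
    by field; rewrite gt_eqF.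
  rewrite halfpowS sqrtrM ?ltW// exprMn -!halfpowS EFinM; over.
rewrite /= ge0_integralZl_EFin //; last 3 first.
- by move=> x _; rewrite lee_fin halfpowS exprn_ge0 ?sqrtr_ge0.
- by apply/measurable_EFinP; apply: continuous_measurable_fun; exact: continuous_halfpowS_cap.
- by rewrite halfpowS exprn_ge0 ?sqrtr_ge0.
by rewrite kE -!EFinM !halfpowS /s [in RHS]exprS; congr EFin; ring.
Qed.

Section InnerProduct.
Context (R : realType) (n : nat).
Implicit Types (u v w : 'rV[R]_n) (Q M : 'M[R]_n) (a : R).

Definition dot (p : nat) (u v : 'rV[R]_p) : R := (u *m v^T) 0 0.

Lemma dotE u v : dot u v = \sum_i u 0 i * v 0 i.
Proof. by rewrite /dot mxE; apply: eq_bigr => i _; rewrite mxE. Qed.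

Lemma dotC u v : dot u v = dot v u.
Proof. by rewrite !dotE; apply: eq_bigr => i _; rewrite mulrC. Qed.

Lemma dotDl u v w : dot (u + v) w = dot u w + dot v w.
Proof. by rewrite /dot mulmxDl mxE. Qed.

Lemma dotDr u v w : dot w (u + v) = dot w u + dot w v.
Proof. by rewrite ![dot w _]dotC dotDl. Qed.

Lemma dotZl a u v : dot (a *: u) v = a * dot u v.
Proof. by rewrite /dot -scalemxAl mxE. Qed.

Lemma dotZr a u v : dot v (a *: u) = a * dot v u.
Proof. by rewrite ![dot v _]dotC dotZl. Qed.

Lemma dotNl u v : dot (- u) v = - dot u v.
Proof. by rewrite /dot mulNmx mxE. Qed.

Lemma dotNr u v : dot v (- u) = - dot v u.
Proof. by rewrite ![dot v _]dotC dotNl. Qed.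

Lemma dot_mulmx u v Q : dot (u *m Q) v = dot u (v *m Q^T).
Proof. by rewrite /dot trmx_mul trmxK mulmxA. Qed.

Lemma dotvv_ge0 u : 0 <= dot u u.
Proof. by rewrite dotE sumr_ge0 // => i _; rewrite -expr2 sqr_ge0. Qed.

Lemma dotvv_eq0 u : (dot u u == 0) = (u == 0).
Proof.
apply/idP/eqP => [|->]; last by rewrite /dot mul0mx mxE.
rewrite dotE psumr_eq0 => [/allP u0|i _]; last by rewrite -expr2 sqr_ge0.
apply/rowP => i; have := u0 i; rewrite mem_index_enum mulf_eq0 orbb mxE.
by move=> /(_ isT)/eqP.
Qed.

Lemma dotvv_gt0 u : u != 0 -> 0 < dot u u.
Proof. by move=> u0; rewrite lt_def dotvv_eq0 u0 dotvv_ge0. Qed.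

Lemma cauchy_schwarz u v : dot u v ^+ 2 <= dot u u * dot v v.
Proof.
have [->|u0] := eqVneq u 0.
  by rewrite /dot !mul0mx mxE expr0n mul0r.
have := dotvv_ge0 (dot u u *: v - dot u v *: u).
rewrite !(dotDl, dotDr, dotNl, dotNr, dotZl, dotZr) (dotC v u).
rewrite (_ : _ + _ = dot u u * (dot u u * dot v v - dot u v ^+ 2)); last by ring.
by rewrite pmulr_rge0 ?dotvv_gt0 // subr_ge0.
Qed.

Definition posdef Q := Q^T = Q /\ forall v, v != 0 -> 0 < dot (v *m Q) v.

Lemma posdef_unitmx Q : posdef Q -> Q \in unitmx.
Proof.
move=> [_ Q0]; rewrite -row_free_unit; apply: inj_row_free => v vQ.
apply/eqP; apply: contraT => /Q0.
by rewrite vQ /dot mul0mx mxE ltxx.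
Qed.

Lemma posdef_conj M Q : M \in unitmx -> posdef Q -> posdef (M *m Q *m M^T).
Proof.
move=> Mu [Qs Q0]; split; first by rewrite !trmx_mul trmxK Qs mulmxA.
move=> v v0; rewrite !mulmxA dot_mulmx trmxK; apply: Q0.
by apply: contra v0 => /eqP vM; rewrite -(mulmxK Mu v) vM mul0mx.
Qed.

(** This is the Cauchy-Schwarz inequality again. *)
Lemma posdef_1sub (l : 'rV[R]_n) : dot l l < 1 -> posdef (1%:M - l^T *m l).
Proof.
move=> l1; split; first by rewrite raddfB /= trmx1 trmx_mul trmxK.
move=> v v0; rewrite mulmxBr mulmx1 mulmxA dotDl dotNl.
rewrite (_ : v *m l^T = (dot l v)%:M); last by rewrite dotC /dot -mx11_scalar.
rewrite mul_scalar_mx dotZl -expr2 subr_gt0 (le_lt_trans (cauchy_schwarz _ _)) //.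
by rewrite gtr_pMl // dotvv_gt0.
Qed.

End InnerProduct.

(** In the block form [Q = (q, b; b^T, Q')] completing the square gives
    [Q = L diag(q - b Q'^-1 b^T, Q') L^T] with [L] unipotent: with first
    coordinate fixed, the quadratic form is a translate of that of [Q'] up to
    a constant. *)
Section SchurComplement.
Context (R : realType) (n : nat) (Q : 'M[R]_(1 + n)).
Hypothesis Qpos : posdef Q.

Let b := ursubmx Q.
Let Q' := drsubmx Q.
Let s := b *m invmx Q'.

Definition schur : R := (ulsubmx Q - s *m b^T) 0 0.

Lemma posdef_drsubmx : posdef Q'.
Proof.
have [Qs Q0] := Qpos; split; first by rewrite /Q' trmx_drsub Qs.
move=> v v0.
have v0' : row_mx (0 : 'rV_1) v != 0.
  by apply: contra v0 => /eqP; rewrite -row_mx0 => /eq_row_mx[_ ->].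
have := Q0 _ v0'; rewrite /dot -[in X in X -> _](submxK Q) mul_row_block !mul0mx !add0r.
by rewrite tr_row_mx mul_row_col trmx0 mulmx0 add0r.
Qed.

Let Q'u : Q' \in unitmx := posdef_unitmx posdef_drsubmx.

Lemma schur_factor :
  Q = block_mx 1%:M s 0 1%:M *m block_mx (schur%:M) 0 0 Q' *m
      block_mx 1%:M 0 s^T 1%:M.
Proof.
have [Qs _] := posdef_drsubmx.
have [Qs' _] := Qpos.
have bE : s *m Q' = b by rewrite mulmxKV.
rewrite !mulmx_block !(mul1mx, mulmx1, mul0mx, mulmx0, add0r, addr0) bE.
rewrite -mx11_scalar /schur.
have bE' : b *m s^T = s *m b^T.
  by rewrite /s trmx_mul trmx_inv Qs mulmxA.
have bT : Q' *m s^T = b^T by rewrite -bE [RHS]trmx_mul Qs.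
rewrite bE' bT subrK /b trmx_ursub Qs'.
by rewrite submxK.
Qed.

(** The Schur complement is the value of the form at [(1, - b Q'^-1)]. *)
Lemma schur_gt0 : 0 < schur.
Proof.
have [_ Q0] := Qpos.
have v0 : row_mx 1%:M (- s) != 0 :> 'rV[R]_(1 + n).
  apply/eqP; rewrite -row_mx0 => /eq_row_mx[/matrixP/(_ 0 0)].
  by rewrite !mxE eqxx => /eqP; rewrite oner_eq0.
have := Q0 _ v0; rewrite /dot {1}schur_factor !mulmxA.
rewrite !(mul_row_block, mul_row_col, tr_row_mx, mul1mx, mulmx1, mul0mx, mulmx0, add0r, addr0).
by rewrite subrr !mul0mx !addr0 trmx1 mulmx1 mxE.
Qed.

Lemma det_schur : \det Q = schur * \det Q'.
Proof.
rewrite [in LHS]schur_factor !det_mulmx !det_ublock det_lblock !det1 !mul1r !mulr1.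
by rewrite det_scalar expr1.
Qed.

Lemma schur_square (t : R) (v : 'rV[R]_n) :
  dot (row_mx (const_mx t) v *m Q) (row_mx (const_mx t) v) =
  dot ((v + t *: s) *m Q') (v + t *: s) + schur * t ^+ 2.
Proof.
have -> : const_mx t = t%:M :> 'rV[R]_1 by apply/matrixP => i j; rewrite !ord1 !mxE.
set L := block_mx 1%:M s 0 1%:M.
have LT : block_mx 1%:M 0 s^T 1%:M = L^T by rewrite tr_block_mx !trmx1 trmx0.
have xL : row_mx t%:M v *m L = row_mx t%:M (v + t *: s).
  by rewrite mul_row_block !mulmx1 mulmx0 addr0 mul_scalar_mx addrC.
rewrite {1}schur_factor LT !mulmxA dot_mulmx trmxK xL mul_row_block !mulmx0 addr0 add0r.
rewrite /dot tr_row_mx mul_row_col mxE addrC -scalar_mxM tr_scalar_mx -scalar_mxM mxE.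
by congr (_ + _); rewrite mxE eqxx mulr1n; ring.
Qed.

End SchurComplement.

Lemma measurable_halfpow_cap (R : realType) (n : nat) (r e p : R) :
  measurable_fun setT (fun t : R => halfpow n (r - e * (t - p) ^+ 2)).
Proof.
apply: (@measurableT_comp _ _ _ _ _ _ (halfpow n)).
  have -> : @halfpow R n = (fun r => \1_(`]0, +oo[%classic : set R) r * Num.sqrt r ^+ n).
    by apply/funext => x; rewrite /halfpow indicE mem_setE in_itv /= andbT.
  apply: measurable_funM; first exact: measurable_indic.
  apply: measurable_funX; apply: continuous_measurable_fun; exact: sqrt_continuous.
apply: measurable_funB => //; apply: measurable_funM => //.
by apply: measurable_funX; apply: measurable_funB.
Qed.

(** By [schur_square] the slice at first coordinate [t] of an ellipsoid is an
    ellipsoid of the lower right block of [Q], with centre moving affinely in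
    [t] and squared radius [r - schur Q * (t - c1) ^+ 2], so that the induction
    is an instance of [cap_integral].  Positivity of the determinant is part of
    the induction because [\det Q] is the product of the Schur complement and
    the determinant of the block. *)
Lemma vol_ellipsoid (R : realType) (n : nat) :
  exists2 k : R, 0 < k & forall (Q : 'M[R]_n) (c : 'rV[R]_n) (r : R), posdef Q ->
    0 < \det Q /\
    vol [set v | dot ((v - c) *m Q) (v - c) < r] =
      (k * halfpow n r / Num.sqrt (\det Q))%:E.
Proof.
elim: n => [|n [k k0 IH]].
  exists 1 => // Q c r _; rewrite det_mx00 ltr01; split=> //=.
  rewrite /halfpow expr0 mulr1 mul1r sqrtr1 divr1 indicE; congr (_%:R%:E).
  have [h|h] := ltP 0 r; first by rewrite mem_set //= dotE big_ord0.
  by rewrite memNset //= dotE big_ord0; apply/negP; rewrite -leNgt.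
have [q q0 capE] := cap_integral R n.
exists (k * q); first exact: mulr_gt0.
move=> Q c r Qpos; pose Q1 : 'M[R]_(1 + n) := Q.
have Q1pos : posdef Q1 by [].
have [d0 _] := IH (drsubmx Q1) 0 0 (posdef_drsubmx Q1pos).
have dE : \det Q = schur Q1 * \det (drsubmx Q1) := det_schur Q1pos.
have e0 := schur_gt0 Q1pos.
split; first by rewrite dE mulr_gt0.
pose c1 := (lsubmx (c : 'rV[R]_(1 + n))) 0 0.
pose c2 := rsubmx (c : 'rV[R]_(1 + n)).
have cE : c = row_mx (const_mx c1 : 'rV_1) c2.
  have -> : const_mx c1 = lsubmx (c : 'rV[R]_(1 + n)).
    by apply/matrixP => i j; rewrite !ord1 [LHS]mxE.
  by rewrite hsubmxK.
pose s := ursubmx Q1 *m invmx (drsubmx Q1).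
pose k' := k / Num.sqrt (\det (drsubmx Q1)).
transitivity (\int[lebesgue_measure]_t
  (k'%:E * (halfpow n (r - schur Q1 * (t - c1) ^+ 2))%:E))%E.
  apply: eq_integral => t _ /=.
  rewrite -EFinM /k' mulrAC -(IH _ (c2 - (t - c1) *: s) _ (posdef_drsubmx Q1pos)).2.
  congr vol; apply/funext => v /=.
  have vE : row_mx (const_mx t : 'rV_1) v - (c : 'rV[R]_(1 + n)) =
            row_mx (const_mx (t - c1) : 'rV_1) (v - c2).
    apply/matrixP => i j; rewrite cE !mxE.
    by case: splitP => k'' _; rewrite !mxE.
  rewrite -[Q]/Q1 vE (schur_square Q1pos) -/s opprB addrA addrAC.
  by rewrite ltrBrDr.
have k'0 : 0 < k' by rewrite divr_gt0 ?sqrtr_gt0.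
rewrite ge0_integralZl_EFin //; last 3 first.
- by move=> t _; rewrite lee_fin mulr_ge0 // exprn_ge0 // sqrtr_ge0.
- by apply/measurable_EFinP; exact: measurable_halfpow_cap.
- exact: ltW.
rewrite capE // -EFinM dE sqrtrM ?ltW // /k'; congr EFin.
by rewrite invfM; ring.
Qed.

Lemma posdef_det_gt0 (R : realType) (n : nat) (Q : 'M[R]_n) : posdef Q -> 0 < \det Q.
Proof.
by have [k k0 H] := vol_ellipsoid R n; move=> /(H Q 0 0) [].
Qed.

(** The unit ball of a Randers norm in orthonormal coordinates [w] is
    [|w| < 1 - l.w].  Squaring turns this into a quadratic inequality, the
    ellipsoid of [1 - l^T l] with centre [- l / (1 - |l|^2)] and squared radius
    [1 / (1 - |l|^2)].  Squaring loses nothing: if [l.w >= 1], then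
    [(1 - l.w)^2 < (l.w)^2 <= |w|^2]. *)
Lemma vol_randers_ball (R : realType) (n : nat) (l : 'rV[R]_n) : dot l l < 1 ->
  exists2 k : R, 0 < k & forall M : 'M[R]_n, M \in unitmx ->
    vol [set y | Num.sqrt (dot (y *m M) (y *m M)) + dot l (y *m M) < 1] =
      (k / `|\det M|)%:E.
Proof.
move=> l1; have [q q0 volE] := vol_ellipsoid R n.
pose Q0 : 'M[R]_n := 1%:M - l^T *m l.
have Q0pos : posdef Q0 by exact: posdef_1sub.
pose r := (1 - dot l l)^-1.
have r0 : 0 < r by rewrite invr_gt0 subr_gt0.
have d0 : 0 < \det Q0 by have [] := volE Q0 0 0 Q0pos.
exists (q * halfpow n r / Num.sqrt (\det Q0)).
  by rewrite divr_gt0 ?sqrtr_gt0 // mulr_gt0 // /halfpow r0 mul1r exprn_gt0 // sqrtr_gt0.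
move=> M Mu.
have [_] := volE _ (- r *: (l *m invmx M)) r (posdef_conj Mu Q0pos).
rewrite !det_mulmx det_tr (_ : _ * _ * \det M = \det M ^+ 2 * \det Q0); last by ring.
rewrite sqrtrM ?sqr_ge0 // sqrtr_sqr.
rewrite invfM mulrCA [_^-1 * (_ / _)]mulrC => <-.
congr vol; apply/funext => y /=; apply/propext.
set w := y *m M.
have -> : dot ((y - - r *: (l *m invmx M)) *m (M *m Q0 *m M^T))
              (y - - r *: (l *m invmx M)) = dot ((w + r *: l) *m Q0) (w + r *: l).
  rewrite !mulmxA dot_mulmx trmxK mulmxBl -scalemxAl mulmxKV //.
  by rewrite scaleNr opprK.
rewrite /Q0 mulmxBr mulmx1 mulmxA dotDl dotNl.
have -> : (w + r *: l) *m l^T = (dot l (w + r *: l))%:M.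
  by rewrite dotC /dot -mx11_scalar.
rewrite mul_scalar_mx dotZl -expr2 !(dotDl, dotDr, dotZl, dotZr) (dotC w l).
have CS := cauchy_schwarz l w.
set ll := dot l l in l1 CS r r0 *; set lw := dot l w in CS *; set ww := dot w w in CS *.
have ww0 : 0 <= ww := dotvv_ge0 w.
have -> : ww + r * lw + (r * lw + r * (r * ll)) - (lw + r * ll) ^+ 2 =
          ww - lw ^+ 2 + 2 * lw + (r - 1).
  by rewrite /r; field; rewrite subr_eq0 gt_eqF.
have -> : (ww - lw ^+ 2 + 2 * lw + (r - 1) < r) = (ww < (1 - lw) ^+ 2).
  by rewrite -subr_gt0 -[RHS]subr_gt0; congr (0 < _); ring.
rewrite -ltrBrDr; split=> h.
  by rewrite -[ww]sqr_sqrtr // ltr_sqr ?nnegrE ?sqrtr_ge0 // (le_trans (sqrtr_ge0 _) (ltW h)).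
have lw1 : 0 < 1 - lw.
  rewrite ltNge; apply/negP => lw1.
  have := dotvv_ge0 l; rewrite -/ll => ll0.
  by nra.
by rewrite -ltr_sqr ?nnegrE ?sqrtr_ge0 ?(ltW lw1) // sqr_sqrtr.
Qed.

(** * Algebra of Randers norms *)

Section QuadraticCalculus.
Context (R : realType) (n : nat).
Implicit Types (z v b : 'rV[R]_n) (N : 'M[R]_n).

Lemma is_derive_linear b z v : is_derive z v (fun z => dot b z) (dot b v).
Proof.
under [X in is_derive _ _ X _]eq_fun do rewrite dotE.
have H i := is_derive_mulfun (is_derive_cstfun (b 0 i) z v) (is_derive_coord z v i).
apply: (is_derive_eq (is_derive_sumfun _ _ H)).
by rewrite dotE; apply: eq_bigr => i _; rewrite mul0r add0r.
Qed.

Lemma is_derive_quadratic N z v :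
  is_derive z v (fun z => dot (z *m N) z) (dot (v *m N) z + dot (z *m N) v).
Proof.
have L (i : 'I_n) : is_derive z v (fun z : 'rV_n => (z *m N) 0 i) ((v *m N) 0 i).
  rewrite mxE; under [X in is_derive _ _ X _]eq_fun do rewrite mxE.
  have H j := is_derive_mulfun (is_derive_coord z v j) (is_derive_cstfun (N j i) z v).
  apply: (is_derive_eq (is_derive_sumfun _ _ H)).
  by apply: eq_bigr => j _; rewrite mulr0 addr0.
under [X in is_derive _ _ X _]eq_fun do rewrite dotE.
have H i := is_derive_mulfun (L i) (is_derive_coord z v i).
apply: (is_derive_eq (is_derive_sumfun _ _ H)).
by rewrite !dotE -big_split.
Qed.

Lemma dot_delta b i : dot b (delta_mx 0 i) = b 0 i.
Proof. by rewrite /dot trmx_delta -colE mxE. Qed.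

End QuadraticCalculus.

Section RandersAlgebra.
Context (R : realType) (n : nat) (A0 : 'M[R]_n) (b0 : 'rV[R]_n).
Context (dA : 'I_n -> 'M[R]_n) (db : 'M[R]_n).
Hypothesis A0pos : posdef A0.
Implicit Types z v : 'rV[R]_n.

Definition riem_norm z := Num.sqrt (dot (z *m A0) z).
Definition randers_norm z := riem_norm z + dot b0 z.
Definition randers_diff z := (riem_norm z)^-1 *: (z *m A0) + b0.
(** Half the Hessian of [F ^+ 2]: [dF dF + F Hess F], where
    [Hess F = Hess alpha] because [F] and [alpha] differ by a linear form. *)
Definition randers_hess z : 'M[R]_n :=
  (randers_diff z)^T *m randers_diff z +
  (randers_norm z / riem_norm z) *:
    (A0 - (riem_norm z ^+ 2)^-1 *: ((z *m A0)^T *m (z *m A0))).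
(** With [dA k] the derivative of the metric along the k-th coordinate, this is
    [[alpha^2]_{x^m y^l} y^m - [alpha^2]_{x^l}], and [riem_spray] is the geodesic
    spray of the metric. *)
Definition riem_cov z : 'rV[R]_n :=
  \row_l (2 * (\sum_k z 0 k * (z *m dA k) 0 l) - dot (z *m dA l) z).
Definition riem_spray z : 'rV[R]_n := 4^-1 *: (riem_cov z *m invmx A0).
(** The covariant derivative [(nabla_z beta)(z)]; row [k] of [db] is the
    derivative of the components of beta along the k-th coordinate. *)
Definition r00 z : R := dot (z *m db) z - 2 * dot b0 (riem_spray z).
(** The covector [[F^2]_{x^m y^l} y^m - [F^2]_{x^l}], written under the
    assumption that beta is closed. *)
Definition randers_cov z : 'rV[R]_n :=
  (2 * (dot (\sum_k z 0 k *: (z *m dA k)) z / (2 * riem_norm z) + dot (z *m db) z))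
     *: randers_diff z +
  (randers_norm z / riem_norm z) *:
    (riem_cov z - (dot (\sum_k z 0 k *: (z *m dA k)) z / riem_norm z ^+ 2) *: (z *m A0)).
Definition randers_spray z : 'rV[R]_n :=
  riem_spray z + (r00 z / (2 * randers_norm z)) *: z.

Lemma riem_norm_gt0 z : z != 0 -> 0 < riem_norm z.
Proof. by move=> z0; rewrite sqrtr_gt0; have [_] := A0pos; apply. Qed.

Lemma riem_norm_sqr z : riem_norm z ^+ 2 = dot (z *m A0) z.
Proof.
have [->|z0] := eqVneq z 0; last by rewrite sqr_sqrtr // ltW // (A0pos.2 _ z0).
by rewrite /riem_norm mul0mx /dot mul0mx mxE sqrtr0 expr0n.
Qed.

Lemma randers_hess_sym z : (randers_hess z)^T = randers_hess z.
Proof.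
rewrite /randers_hess linearD /= linearZ /= linearB /= linearZ /=.
by rewrite !trmx_mul !trmxK A0pos.1.
Qed.

Lemma mul_outer (v p q : 'rV[R]_n) : v *m (p^T *m q) = dot v p *: q.
Proof.
by rewrite mulmxA (mx11_scalar (v *m p^T)) mul_scalar_mx.
Qed.

Lemma mul_randers_hess v z : v *m randers_hess z =
  dot v (randers_diff z) *: randers_diff z +
  (randers_norm z / riem_norm z) *:
    (v *m A0 - (dot v (z *m A0) / riem_norm z ^+ 2) *: (z *m A0)).
Proof.
rewrite /randers_hess mulmxDr mul_outer -scalemxAr mulmxBr -scalemxAr mul_outer.
by rewrite scalerA [_^-1 * _]mulrC.
Qed.

Section NonZero.
Variable z : 'rV[R]_n.
Hypotheses (z0 : z != 0) (Fz : 0 < randers_norm z).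

Let alpha_neq0 : riem_norm z != 0.
Proof. by rewrite gt_eqF // riem_norm_gt0. Qed.

Lemma randers_euler : dot z (randers_diff z) = randers_norm z.
Proof.
rewrite dotDr dotZr [dot z (z *m A0)]dotC -riem_norm_sqr [dot z b0]dotC.
by rewrite expr2 mulKf.
Qed.

Lemma mul_randers_hess_self :
  z *m randers_hess z = randers_norm z *: randers_diff z.
Proof.
rewrite mul_randers_hess randers_euler [dot z (z *m A0)]dotC -riem_norm_sqr.
by rewrite mulfV ?expf_neq0 // scale1r subrr scaler0 addr0.
Qed.

(** If [v] is in the kernel, pairing with [z] and using [z g = F dF] gives
    [dF v = 0]; what is left says that [v A0] is proportional to [z A0], hence
    [v] to [z], and [dF z = F > 0] leaves only [v = 0]. *)
Lemma randers_hess_unitmx : randers_hess z \in unitmx.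
Proof.
rewrite -row_free_unit; apply: inj_row_free => v vg.
have vphi : dot v (randers_diff z) = 0.
  have : dot (v *m randers_hess z) z = 0 by rewrite vg /dot mul0mx mxE.
  rewrite dot_mulmx randers_hess_sym mul_randers_hess_self dotZr => /eqP.
  by rewrite mulf_eq0 gt_eqF //= => /eqP.
move: vg; rewrite mul_randers_hess vphi scale0r add0r => /eqP.
rewrite scaler_eq0 mulf_eq0 invr_eq0 (gt_eqF Fz) (negPf alpha_neq0) /= subr_eq0 => /eqP.
rewrite scalemxAl => /(congr1 (fun w => w *m invmx A0)).
rewrite !mulmxK ?posdef_unitmx // => vE.
move: vphi; rewrite vE dotZl randers_euler => /eqP.
by rewrite mulf_eq0 (gt_eqF Fz) orbF => /eqP ->; rewrite scale0r.
Qed.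

(** The only non-formal input is that the Riemannian spray is dual to
    [riem_cov / 4], whose pairing with [z] is a quarter of the derivative of
    the metric along [z]. *)
Lemma randers_spray_eq : randers_cov z = 4 *: (randers_spray z *m randers_hess z).
Proof.
have Au := posdef_unitmx A0pos.
have tE : dot (riem_cov z) z = dot (\sum_k z 0 k *: (z *m dA k)) z.
  set t := (RHS).
  have -> : riem_cov z = 2 *: (\sum_k z 0 k *: (z *m dA k)) - \row_l dot (z *m dA l) z.
    apply/rowP => l; rewrite !mxE summxE; congr (2 * _ - _).
    by apply: eq_bigr => k _; rewrite !mxE.
  rewrite dotDl dotNl dotZl -/t.
  suff -> : dot (\row_l dot (z *m dA l) z) z = t by ring.
  rewrite /t /dot mulmx_suml summxE [LHS]mxE; apply: eq_bigr => k _.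
  by rewrite -scalemxAl [RHS]mxE [in LHS]mxE [z^T _ _]mxE mulrC.
have GA : riem_spray z *m A0 = 4^-1 *: riem_cov z.
  by rewrite -scalemxAl mulmxKV.
have Gp : dot (riem_spray z) (z *m A0) = 4^-1 * dot (\sum_k z 0 k *: (z *m dA k)) z.
  by rewrite dotC dot_mulmx A0pos.1 GA dotZr dotC tE.
rewrite /randers_spray mulmxDl -scalemxAl mul_randers_hess_self mul_randers_hess GA Gp.
rewrite {1}/randers_diff dotDr dotZr Gp [dot _ b0]dotC /r00 /randers_cov.
move: alpha_neq0 (Fz); set al := riem_norm z; set F := randers_norm z.
set t := dot (\sum_k _) z; set bG := dot b0 _; set be := dot (z *m db) z.
move=> al0 F0; apply/rowP => i; rewrite !mxE.
by field; rewrite al0 gt_eqF.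
Qed.

End NonZero.
End RandersAlgebra.

(** * The spray of a Randers metric with closed one-form *)

Lemma near_neq0 (R : realType) (n : nat) (y : 'rV[R]_n) :
  y != 0 -> \forall z \near y, z != 0.
Proof.
move=> y0; have [i yi] : exists i, y 0 i != 0.
  by apply/existsP; apply: contra_neqT y0; rewrite negb_exists => /forallP h;
    apply/rowP => i; rewrite mxE; apply/eqP; move: (h i); rewrite negbK.
have ci : {for y, continuous (fun z : 'rV[R]_n => z 0 i)}.
  exact: coord_continuous.
have H : \forall t \near y 0 i, t != 0.
  by apply: open_nbhs_nbhs; split=> //; exact: open_neq.
near=> z; apply/eqP => zE; have : z 0 i != 0 by near: z; exact: (ci _ H).
by rewrite zE mxE eqxx.
Unshelve. all: by end_near.
Qed.

Section RandersCalculus.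
Context (R : realType) (n : nat) (A0 : 'M[R]_n) (b0 : 'rV[R]_n).
Hypothesis A0pos : posdef A0.
Implicit Types z v : 'rV[R]_n.

Let alpha := riem_norm A0.
Let Fz := randers_norm A0 b0.

Lemma is_derive_riem_norm z v : z != 0 ->
  is_derive z v alpha (dot (z *m A0) v / alpha z).
Proof.
move=> z0; have q0 : 0 < dot (z *m A0) z by exact: A0pos.2.
have a0 : alpha z != 0 by rewrite gt_eqF // riem_norm_gt0.
have H := is_derive_sqrtfun (f := fun z => dot (z *m A0) z) q0 (is_derive_quadratic A0 z v).
rewrite /alpha /riem_norm; apply: (is_derive_eq H).
rewrite dot_mulmx A0pos.1 dotC -/(riem_norm A0 z) -/alpha.
by field.
Qed.

Lemma is_derive_randers_norm z v : z != 0 ->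
  is_derive z v Fz (dot (randers_diff A0 b0 z) v).
Proof.
move=> z0.
apply: (is_derive_eq (is_derive_addfun (is_derive_riem_norm v z0) (is_derive_linear b0 z v))).
by rewrite dotDl dotZl mulrC.
Qed.

Lemma is_derive_row_mul (N : 'M[R]_n) z v i :
  is_derive z v (fun z : 'rV_n => (z *m N) 0 i) ((v *m N) 0 i).
Proof.
rewrite -!dot_delta dot_mulmx dotC.
under [X in is_derive _ _ X _]eq_fun do rewrite -dot_delta dot_mulmx dotC.
exact: is_derive_linear.
Qed.

Lemma is_derive_randers_diff z v i : z != 0 ->
  is_derive z v (fun z => randers_diff A0 b0 z 0 i)
    (((v *m A0) 0 i - dot v (z *m A0) / alpha z ^+ 2 * (z *m A0) 0 i) / alpha z).
Proof.
move=> z0; have a0 : alpha z != 0 by rewrite gt_eqF // riem_norm_gt0.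
under [X in is_derive _ _ X _]eq_fun do rewrite 2!mxE.
have H := is_derive_addfun (is_derive_mulfun
  (is_derive_invfun a0 (is_derive_riem_norm v z0)) (is_derive_row_mul A0 z v i))
  (is_derive_cstfun (b0 0 i) z v).
apply: (is_derive_eq H); rewrite addr0 (dotC v) -/alpha.
by field.
Qed.

End RandersCalculus.

(** Everything takes place at one point [u0] of a chart where the metric is
    [Af u] and the one-form [bf u].  Closedness of the form is the symmetry of
    the matrix [db] of its partial derivatives. *)
Section RandersSpray.
Context (R : realType) (n : nat) (M : Type) (F : tangent_function R M n).
Context (c : chart R M n) (Af : 'rV[R]_n -> 'M[R]_n) (bf : 'rV[R]_n -> 'rV[R]_n).
Context (u0 : 'rV[R]_n) (dA : 'I_n -> 'M[R]_n) (db : 'M[R]_n).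
Let A0 := Af u0.
Let b0 := bf u0.
Hypothesis sqFE : forall u y, sqF F c u y = randers_norm (Af u) (bf u) y ^+ 2.
Hypothesis derA : forall k i j,
  is_derive u0 (delta_mx 0 k) (fun u => Af u i j) (dA k i j).
Hypothesis derb : forall k j,
  is_derive u0 (delta_mx 0 k) (fun u => bf u 0 j) (db k j).
Hypothesis A0pos : posdef A0.
Hypothesis dAsym : forall k, (dA k)^T = dA k.
Hypothesis dbsym : db^T = db.
Hypothesis Fpos : forall z, z != 0 -> 0 < randers_norm A0 b0 z.

Let alpha := riem_norm A0.
Let Fz := randers_norm A0 b0.

Lemma pderiv_sqF z j : z != 0 ->
  pderiv j (sqF F c u0) z = 2 * (Fz z * randers_diff A0 b0 z 0 j).
Proof.
move=> z0; rewrite /pderiv.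
have -> : sqF F c u0 = fun z => Fz z * Fz z.
  by apply/funext => x; rewrite sqFE expr2.
have H := is_derive_randers_norm b0 A0pos (delta_mx 0 j) z0.
rewrite (@derive_val _ _ _ _ _ _ _ (is_derive_mulfun H H)) dot_delta.
by rewrite -/A0 -/b0 -/Fz; ring.
Qed.

Lemma fundamental_tensorE y : y != 0 ->
  fundamental_tensor F c u0 y = randers_hess A0 b0 y.
Proof.
move=> y0; apply/matrixP => i j; rewrite mxE /pderiv.
have H := is_derive_mulfun (is_derive_cstfun 2 y (delta_mx 0 i)) (is_derive_mulfun
  (is_derive_randers_norm b0 A0pos (delta_mx 0 i) y0)
  (is_derive_randers_diff b0 A0pos (delta_mx 0 i) j y0)).
rewrite (near_eq_derive (g := fun z => 2 * (Fz z * randers_diff A0 b0 z 0 j))); last first.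
  by apply: filterS (near_neq0 y0) => z z0; exact: pderiv_sqF.
rewrite (@derive_val _ _ _ _ _ _ _ H) dot_delta.
have -> : randers_hess A0 b0 y i j = ((delta_mx 0 i : 'rV_n) *m randers_hess A0 b0 y) 0 j.
  by rewrite -rowE [RHS]mxE.
rewrite mul_randers_hess (dotC _ (randers_diff _ _ _)) dot_delta -/alpha -/Fz.
set phi := randers_diff A0 b0 y; set p := y *m A0; set q := delta_mx 0 i *m A0.
have a0 : alpha y != 0 by rewrite gt_eqF // riem_norm_gt0.
by move: phi p q => phi p q; rewrite !mxE; field.
Qed.

Lemma is_derive_quad_coef z k :
  is_derive u0 (delta_mx 0 k) (fun u => dot (z *m Af u) z) (dot (z *m dA k) z).
Proof.
have H i j := is_derive_mulfun (is_derive_cstfun (z 0 i) u0 (delta_mx 0 k)) (derA k i j).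
have H1 j := is_derive_sumfun (index_enum 'I_n) xpredT (fun i => H i j).
have H2 j := is_derive_mulfun (H1 j) (is_derive_cstfun (z 0 j) u0 (delta_mx 0 k)).
have H3 := is_derive_sumfun (index_enum 'I_n) xpredT H2.
rewrite dotE; under [X in is_derive _ _ X _]eq_fun do rewrite dotE.
under [X in is_derive _ _ X _]eq_fun do under eq_bigr do rewrite mxE.
apply: (is_derive_eq H3); apply: eq_bigr => j _; rewrite mulr0 addr0 mxE.
by congr (_ * _); apply: eq_bigr => i _; rewrite mul0r add0r.
Qed.

Lemma is_derive_lin_coef z k :
  is_derive u0 (delta_mx 0 k) (fun u => dot (bf u) z) (dot (row k db) z).
Proof.
have H j := is_derive_mulfun (derb k j) (is_derive_cstfun (z 0 j) u0 (delta_mx 0 k)).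
have H3 := is_derive_sumfun (index_enum 'I_n) xpredT H.
rewrite dotE; under [X in is_derive _ _ X _]eq_fun do rewrite dotE.
by apply: (is_derive_eq H3); apply: eq_bigr => j _; rewrite mulr0 addr0 [row _ _ _ _]mxE.
Qed.

Lemma pderiv_sqF_base z k : z != 0 ->
  pderiv k (fun w => sqF F c w z) u0 =
  2 * (Fz z * (dot (z *m dA k) z / (2 * alpha z) + (z *m db) 0 k)).
Proof.
move=> z0; rewrite /pderiv.
have -> : (fun w => sqF F c w z) =
    fun w => randers_norm (Af w) (bf w) z * randers_norm (Af w) (bf w) z.
  by apply/funext => x; rewrite sqFE expr2.
have q0 : 0 < dot (z *m A0) z by exact: A0pos.2.
have H := is_derive_addfun
  (is_derive_sqrtfun (f := fun u => dot (z *m Af u) z) q0 (is_derive_quad_coef z k))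
  (is_derive_lin_coef z k).
rewrite (@derive_val _ _ _ _ _ _ _ (is_derive_mulfun H H)).
have -> : dot (row k db) z = (z *m db) 0 k.
  by rewrite rowE dot_mulmx dbsym dotC dot_delta.
by rewrite -/(riem_norm A0 z) -/alpha -/(randers_norm A0 b0 z) -/Fz; ring.
Qed.

(** The terms with derivatives of the one-form cancel but for a multiple of
    [dF]: symmetry of [db] identifies the two ways to contract it with [y]. *)
Lemma spray_covector y l : y != 0 ->
  \sum_k pderiv l (fun z => pderiv k (fun w => sqF F c w z) u0) y * y 0 k
    - pderiv l (fun w => sqF F c w y) u0 = randers_cov A0 b0 dA db y 0 l.
Proof.
move=> y0; have a0 : alpha y != 0 by rewrite gt_eqF // riem_norm_gt0.
have HD k : pderiv l (fun z => pderiv k (fun w => sqF F c w z) u0) y =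
    2 * (randers_diff A0 b0 y 0 l * (dot (y *m dA k) y / (2 * alpha y) + (y *m db) 0 k)
      + Fz y * ((y *m dA k) 0 l / alpha y
                - dot (y *m dA k) y * (y *m A0) 0 l / (2 * alpha y ^+ 3) + db l k)).
  rewrite {1}/pderiv (near_eq_derive (g := fun z => 2 * (Fz z *
     ((dot (z *m dA k) z * (2 * alpha z)^-1) + (z *m db) 0 k)))); last first.
    by near=> z; apply: pderiv_sqF_base; near: z; exact: near_neq0.
  have a20 : 2 * alpha y != 0 by rewrite mulf_neq0 // pnatr_eq0.
  have Ha := is_derive_mulfun (is_derive_cstfun 2 y (delta_mx 0 l))
    (is_derive_riem_norm A0pos (delta_mx 0 l) y0).
  have H := is_derive_mulfun (is_derive_cstfun 2 y (delta_mx 0 l)) (is_derive_mulfun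
    (is_derive_randers_norm b0 A0pos (delta_mx 0 l) y0)
    (is_derive_addfun (is_derive_mulfun (is_derive_quadratic (dA k) y (delta_mx 0 l))
       (is_derive_invfun (f := fun z => 2 * alpha z) a20 Ha))
       (is_derive_row_mul db y (delta_mx 0 l) k))).
  rewrite (@derive_val _ _ _ _ _ _ _ H) !dot_delta.
  have -> : dot (delta_mx 0 l *m dA k) y = (y *m dA k) 0 l.
    by rewrite dot_mulmx dAsym dotC dot_delta.
  rewrite -rowE [row l db 0 k]mxE -/A0 -/b0 -/Fz -/alpha; field.
  exact: a0.
rewrite pderiv_sqF_base //; under eq_bigr do rewrite HD.
set phi := randers_diff A0 b0 y 0 l; set p := (y *m A0) 0 l.
set T := \sum_k y 0 k *: (y *m dA k).
have tE : \sum_k y 0 k * dot (y *m dA k) y = dot T y.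
  by rewrite /dot mulmx_suml summxE; apply: eq_bigr => k _; rewrite -scalemxAl [RHS]mxE.
have TE : \sum_k y 0 k * (y *m dA k) 0 l = T 0 l.
  by rewrite summxE; apply: eq_bigr => k _; rewrite [RHS]mxE.
have bE : \sum_k y 0 k * (y *m db) 0 k = dot (y *m db) y.
  by rewrite dotE; apply: eq_bigr => k _; rewrite mulrC.
have b'E : \sum_k y 0 k * db l k = (y *m db) 0 l.
  by rewrite mxE; apply: eq_bigr => k _; rewrite -[in LHS]dbsym mxE.
transitivity (2 * (phi * (dot T y / (2 * alpha y) + dot (y *m db) y) +
   Fz y * (T 0 l / alpha y - dot T y * p / (2 * alpha y ^+ 3) + (y *m db) 0 l))
   - 2 * (Fz y * (dot (y *m dA l) y / (2 * alpha y) + (y *m db) 0 l))).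
  congr (_ - _); rewrite -tE -TE -bE -b'E.
  rewrite !mulr_suml -sumrB -!big_split /= !mulr_sumr -big_split /= mulr_sumr.
  by apply: eq_bigr => k _; ring.
have combE (r1 r2 r3 : R) (P Q S : 'rV[R]_n) :
    (r1 *: P + r2 *: (Q - r3 *: S)) 0 l = r1 * P 0 l + r2 * (Q 0 l - r3 * S 0 l).
  by rewrite !mxE.
rewrite /randers_cov combE -/alpha -/Fz -/T -/phi -/p [riem_cov _ _ _ _]mxE TE.
by field.
Unshelve. all: by end_near.
Qed.

Theorem spray_randers y i : y != 0 ->
  spray F c i u0 y = randers_spray A0 b0 dA db y 0 i.
Proof.
move=> y0; rewrite /spray fundamental_tensorE //.
under eq_bigr do rewrite spray_covector //.
rewrite randers_spray_eq //; last exact: Fpos.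
have gu := randers_hess_unitmx A0pos y0 (Fpos y0).
set g := randers_hess _ _ _ in gu *; set x := randers_spray _ _ _ _ _.
transitivity (4^-1 * (4 *: (x *m g) *m (invmx g)^T) 0 i).
  by rewrite mxE; congr (_ * _); apply: eq_bigr => l _; rewrite [_^T _ _]mxE mulrC.
rewrite trmx_inv randers_hess_sym -/g // -scalemxAl mulmxK // mxE.
by rewrite mulKf // pnatr_eq0.
Qed.

End RandersSpray.

(** * Divergence of the spray and S-curvature *)

Section Divergence.
Context (R : realType) (n : nat) (A0 : 'M[R]_n) (b0 : 'rV[R]_n).
Context (dA : 'I_n -> 'M[R]_n) (db : 'M[R]_n).
Hypothesis A0pos : posdef A0.
Hypothesis dAsym : forall k, (dA k)^T = dA k.
Implicit Types (z y v : 'rV[R]_n).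

(** Twice the Christoffel symbols of the first kind before symmetrization in
    [i], [j]: [riem_cov] is the associated quadratic form. *)
Definition christoffel (l : 'I_n) : 'M[R]_n :=
  \matrix_(i, j) (2 * dA j i l - dA l i j).

Lemma riem_covE z l : riem_cov dA z 0 l = dot (z *m christoffel l) z.
Proof.
rewrite mxE !dotE mulr_sumr -sumrB; apply: eq_bigr => k _.
rewrite mulrCA [_ * z 0 k]mulrC [X in _ = X]mulrC -mulrBr; congr (_ * _).
by rewrite !mxE mulr_sumr -sumrB; apply: eq_bigr => i _; rewrite mxE; ring.
Qed.

Lemma is_derive_riem_cov y v l : is_derive y v (fun z => riem_cov dA z 0 l)
  (dot (v *m christoffel l) y + dot (y *m christoffel l) v).
Proof.
under [X in is_derive _ _ X _]eq_fun do rewrite riem_covE.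
exact: is_derive_quadratic.
Qed.

Lemma is_derive_riem_spray y v i : is_derive y v (fun z => riem_spray A0 dA z 0 i)
  (4^-1 * \sum_l (dot (v *m christoffel l) y + dot (y *m christoffel l) v)
                 * invmx A0 l i).
Proof.
under [X in is_derive _ _ X _]eq_fun do rewrite 2!mxE.
have H l := is_derive_mulfun (is_derive_riem_cov y v l) (is_derive_cstfun (invmx A0 l i) y v).
have H1 := is_derive_mulfun (is_derive_cstfun 4^-1 y v)
  (is_derive_sumfun (index_enum 'I_n) xpredT H).
apply: (is_derive_eq H1); rewrite mul0r add0r; congr (_ * _).
by apply: eq_bigr => l _; rewrite mulr0 addr0.
Qed.

(** Of the three derivatives of the metric in a Christoffel symbol two are
    exchanged by the symmetry of the inverse metric and cancel. *)
Lemma div_riem_spray y :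
  \sum_k 4^-1 * (\sum_l (dot (delta_mx 0 k *m christoffel l) y
      + dot (y *m christoffel l) (delta_mx 0 k)) * invmx A0 l k) =
  2^-1 * \sum_j y 0 j * \tr (dA j *m invmx A0).
Proof.
have iS k l : invmx A0 l k = invmx A0 k l.
  by rewrite -[in LHS]A0pos.1 -trmx_inv mxE.
pose T j k l := y 0 j * invmx A0 l k * dA j k l.
pose U j k l := y 0 j * invmx A0 l k * dA k j l.
pose W j k l := y 0 j * invmx A0 l k * dA l j k.
have UW : \sum_k \sum_l \sum_j U j k l = \sum_k \sum_l \sum_j W j k l.
  rewrite exchange_big /=; apply: eq_bigr => k _; apply: eq_bigr => l _.
  by apply: eq_bigr => j _; rewrite /U /W iS.
transitivity (2^-1 * (\sum_k \sum_l \sum_j T j k l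
                      + (\sum_k \sum_l \sum_j U j k l - \sum_k \sum_l \sum_j W j k l))).
  rewrite -sumrB -big_split mulr_sumr; apply: eq_bigr => k _ /=.
  rewrite -sumrB -big_split !mulr_sumr; apply: eq_bigr => l _ /=.
  rewrite -sumrB -big_split dot_delta dotE [(y *m _) 0 k]mxE -big_split /=.
  rewrite mulr_suml !mulr_sumr; apply: eq_bigr => j _.
  rewrite -rowE !mxE /T /U /W.
  have -> : dA l j k = dA l k j by rewrite -[in LHS](dAsym l) mxE.
  by field.
rewrite UW subrr addr0; congr (_ * _).
rewrite exchange_big /=; under eq_bigr do rewrite exchange_big /=.
rewrite exchange_big /=; apply: eq_bigr => j _.
rewrite /mxtrace mulr_sumr exchange_big; apply: eq_bigr => k _ /=.
rewrite mxE mulr_sumr; apply: eq_bigr => l _.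
by rewrite /T -mulrA [_ * dA _ _ _]mulrC.
Qed.

Lemma dot_mulmxr_sum (I : finType) (f : I -> 'M[R]_n) (a : I -> R) z :
  dot (z *m (\sum_i a i *: f i)) z = \sum_i a i * dot (z *m f i) z.
Proof.
rewrite mulmx_sumr /dot mulmx_suml summxE; apply: eq_bigr => i _.
by rewrite -scalemxAr -scalemxAl mxE.
Qed.

Lemma r00_quadratic : exists N : 'M[R]_n, forall z, r00 A0 b0 dA db z = dot (z *m N) z.
Proof.
exists (db - (2 * 4^-1) *: \sum_l (dot b0 (row l (invmx A0))) *: christoffel l) => z.
rewrite mulmxBr dotDl dotNl -scalemxAr dotZl dot_mulmxr_sum /r00; congr (_ - _).
rewrite -mulrA; congr (_ * _); rewrite /riem_spray dotZr; congr (_ * _).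
rewrite mulmx_sum_row dotC /dot mulmx_suml summxE; apply: eq_bigr => l _.
by rewrite -scalemxAl mxE riem_covE mulrC -/(dot _ _) dotC.
Qed.

Hypothesis Fpos : forall z, z != 0 -> 0 < randers_norm A0 b0 z.

(** The projective factor is a quadratic form over a norm, whence Euler's
    formula in degree one. *)
Lemma is_derive_projective y : y != 0 -> exists dP : 'rV[R]_n -> R,
  (forall v, is_derive y v
     (fun z => r00 A0 b0 dA db z / (2 * randers_norm A0 b0 z)) (dP v)) /\
  \sum_k y 0 k * dP (delta_mx 0 k) = r00 A0 b0 dA db y / (2 * randers_norm A0 b0 y).
Proof.
move=> y0; have [N NE] := r00_quadratic.
have F0 := Fpos y0; set Fz := randers_norm A0 b0.
have F20 : 2 * Fz y != 0 by rewrite mulf_neq0 ?pnatr_eq0 // gt_eqF.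
have H w := is_derive_mulfun (is_derive_quadratic N y w)
  (is_derive_invfun (f := fun z => 2 * Fz z) F20
     (is_derive_mulfun (is_derive_cstfun 2 y w) (is_derive_randers_norm b0 A0pos w y0))).
exists (fun w => (2 * Fz y)^-1 * (dot (w *m N) y + dot (y *m N) w)
   - dot (y *m N) y * (2 * dot (randers_diff A0 b0 y) w) / (2 * Fz y) ^+ 2); split=> [w|].
  under [X in is_derive _ _ X _]eq_fun do rewrite NE.
  by apply: (is_derive_eq (H w)); ring.
have S1 : \sum_k y 0 k * dot (delta_mx 0 k *m N) y = dot (y *m N) y.
  rewrite [in RHS]dot_mulmx [RHS]dotE; apply: eq_bigr => k _.
  by rewrite dot_mulmx dotC dot_delta.
have S2 : \sum_k y 0 k * dot (y *m N) (delta_mx 0 k) = dot (y *m N) y.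
  by rewrite [RHS]dotE; apply: eq_bigr => k _; rewrite dot_delta mulrC.
have S3 : \sum_k y 0 k * dot (randers_diff A0 b0 y) (delta_mx 0 k) = Fz y.
  rewrite /Fz -(randers_euler b0 A0pos y0) [RHS]dotE.
  by apply: eq_bigr => k _; rewrite dot_delta.
transitivity ((2 * Fz y)^-1 * (\sum_k y 0 k * dot (delta_mx 0 k *m N) y
     + \sum_k y 0 k * dot (y *m N) (delta_mx 0 k))
   - dot (y *m N) y * (2 * \sum_k y 0 k * dot (randers_diff A0 b0 y) (delta_mx 0 k))
     / (2 * Fz y) ^+ 2); last first.
  by rewrite S1 S2 S3 NE -/Fz; field; rewrite gt_eqF.
rewrite -big_split !mulr_sumr mulr_suml -sumrB; apply: eq_bigr => k _ /=.
by ring.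
Qed.

End Divergence.

Section SCurvature.
Context (R : realType) (n : nat) (M : Type) (F : tangent_function R M n).
Context (c : chart R M n) (Af : 'rV[R]_n -> 'M[R]_n) (bf : 'rV[R]_n -> 'rV[R]_n).
Context (x : M) (dA : 'I_n -> 'M[R]_n) (db : 'M[R]_n).
Let u0 := cmap c x.
Let A0 := Af u0.
Let b0 := bf u0.
Hypothesis sqFE : forall u y, sqF F c u y = randers_norm (Af u) (bf u) y ^+ 2.
Hypothesis derA : forall k i j,
  is_derive u0 (delta_mx 0 k) (fun u => Af u i j) (dA k i j).
Hypothesis derb : forall k j,
  is_derive u0 (delta_mx 0 k) (fun u => bf u 0 j) (db k j).
Hypothesis A0pos : posdef A0.
Hypothesis dAsym : forall k, (dA k)^T = dA k.
Hypothesis dbsym : db^T = db.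
Hypothesis Fpos : forall z, z != 0 -> 0 < randers_norm A0 b0 z.

(** A density of this form arises when the unit balls are images of one body by
    linear maps that carry a fixed Euclidean metric to [Af u]. *)
Lemma pderiv_ln_density (K : R) k : 0 < K ->
  (\forall u \near u0, bh_density F c u = K * Num.sqrt (\det (Af u))) ->
  pderiv k (fun u => ln (bh_density F c u)) u0 = 2^-1 * \tr (dA k *m invmx A0).
Proof.
move=> K0 KE; have d0 := posdef_det_gt0 A0pos.
rewrite /pderiv (near_eq_derive (g := fun u => ln (K * Num.sqrt (\det (Af u))))); last first.
  by apply: filterS KE => u ->.
have sd0 : 0 < Num.sqrt (\det A0) by rewrite sqrtr_gt0.
have Hd := is_derive_sqrtfun (f := fun u => \det (Af u)) d0 (is_derive_det (derA k)).
have HK := is_derive_mulfun (is_derive_cstfun K u0 (delta_mx 0 k)) Hd.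
have Hl := is_derive1_ln (mulr_gt0 K0 sd0).
have H := is_derive_compfun (f := fun u => K * Num.sqrt (\det (Af u))) HK Hl.
rewrite (@derive_val _ _ _ _ _ _ _ H) -/A0.
have -> : \tr (dA k *m \adj A0) = \det A0 * \tr (dA k *m invmx A0).
  rewrite /invmx posdef_unitmx // -scalemxAr mxtraceZ mulrA mulfV ?mul1r //.
  by rewrite gt_eqF.
rewrite -[in X in X / _](sqr_sqrtr (ltW d0)).
by field; rewrite !gt_eqF.
Qed.

(** The divergence of [P y] is [y dP + n P = (n + 1) P], and that of the
    Riemannian spray cancels with the term of the density. *)
Theorem S_curvature_randers (K : R) y : 0 < K ->
  (\forall u \near u0, bh_density F c u = K * Num.sqrt (\det (Af u))) ->
  y != 0 ->
  S_curvature F c x y =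
    n.+1%:R * (r00 A0 b0 dA db y / (2 * randers_norm A0 b0 y)).
Proof.
move=> K0 KE y0; rewrite /S_curvature -/u0.
under [X in _ - X]eq_bigr do rewrite (pderiv_ln_density _ K0 KE).
have [dP [HP eulerP]] := is_derive_projective dA db A0pos Fpos y0.
have Hk k : pderiv k (spray F c k u0) y =
   4^-1 * (\sum_l (dot (delta_mx 0 k *m christoffel dA l) y
      + dot (y *m christoffel dA l) (delta_mx 0 k)) * invmx A0 l k)
   + (y 0 k * dP (delta_mx 0 k) + r00 A0 b0 dA db y / (2 * randers_norm A0 b0 y)).
  rewrite /pderiv (near_eq_derive (g := fun z => riem_spray A0 dA z 0 k +
     r00 A0 b0 dA db z / (2 * randers_norm A0 b0 z) * z 0 k)); last first.
    near=> z; have z0 : z != 0 by near: z; exact: near_neq0.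
    by rewrite (spray_randers sqFE derA derb) // !mxE.
  have H := is_derive_addfun (is_derive_riem_spray A0 dA y (delta_mx 0 k) k)
    (is_derive_mulfun (HP (delta_mx 0 k)) (is_derive_coord y (delta_mx 0 k) k)).
  rewrite (@derive_val _ _ _ _ _ _ _ H) [delta_mx 0 k 0 k]mxE !eqxx mulr1.
  by rewrite [dP _ * _]mulrC.
under [X in X - _]eq_bigr do rewrite Hk.
rewrite !big_split /= eulerP (div_riem_spray A0pos dAsym) sumr_const card_ord.
have -> : \sum_k y 0 k * (2^-1 * \tr (dA k *m invmx A0)) =
          2^-1 * \sum_j y 0 j * \tr (dA j *m invmx A0).
  by rewrite mulr_sumr; apply: eq_bigr => k _; rewrite mulrCA.
rewrite addrAC subrr add0r -(natr1 n) [RHS]mulrDl mul1r [RHS]addrC.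
by rewrite -[X in _ + X = _]mulr_natl.
Unshelve. all: by end_near.
Qed.

End SCurvature.

(** * Randers metrics with constant coefficients in a frame *)

Lemma is_derive_mulmx (R : realType) (V : normedModType R) (m n p : nat)
    (P : V -> 'M[R]_(m, n)) (Q : V -> 'M[R]_(n, p)) (x v : V)
    (dP : 'M[R]_(m, n)) (dQ : 'M[R]_(n, p)) :
  (forall i j, is_derive x v (fun u => P u i j) (dP i j)) ->
  (forall i j, is_derive x v (fun u => Q u i j) (dQ i j)) ->
  forall i j, is_derive x v (fun u => (P u *m Q u) i j)
    ((dP *m Q x + P x *m dQ) i j).
Proof.
move=> HP HQ i j.
under [X in is_derive _ _ X _]eq_fun do rewrite mxE.
have H k := is_derive_mulfun (HP i k) (HQ k j).
apply: (is_derive_eq (is_derive_sumfun _ _ H)).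
by rewrite mxE big_split !mxE.
Qed.

(** The rows of [Bf u] form an orthonormal frame near a point; the one-form has
    constant components [l] in it, and [C i j] are the components of the bracket
    of the i-th and j-th frame fields.  By [lC] the one-form vanishes on all
    brackets. *)
Section Frame.
Context (R : realType) (n : nat) (M : Type) (F : tangent_function R M n).
Context (c : chart R M n) (Af Bf : 'rV[R]_n -> 'M[R]_n) (l : 'rV[R]_n) (x : M).
Let u0 := cmap c x.
Let A0 := Af u0.
Let B0 := Bf u0.
Let bf u := l *m Bf u *m Af u.
Let b0 := bf u0.
Context (dA dB : 'I_n -> 'M[R]_n) (C : 'I_n -> 'I_n -> 'rV[R]_n).
Hypothesis FE : forall u y, F c (cinv c u) y = randers_norm (Af u) (bf u) y.
Hypothesis derA : forall k i j,
  is_derive u0 (delta_mx 0 k) (fun u => Af u i j) (dA k i j).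
Hypothesis derB : forall k i j,
  is_derive u0 (delta_mx 0 k) (fun u => Bf u i j) (dB k i j).
Hypothesis orth : \forall u \near u0, Bf u *m Af u *m (Bf u)^T = 1%:M.
Hypothesis l_lt1 : dot l l < 1.
Hypothesis brC : forall i j,
  \sum_k (B0 i k *: row j (dB k) - B0 j k *: row i (dB k)) = C i j *m B0.
Hypothesis lC : forall i j, dot l (C i j) = 0.

Lemma frame_metric (A B : 'M[R]_n) : B *m A *m B^T = 1%:M ->
  [/\ B \in unitmx, A = invmx B *m (invmx B)^T & B *m A = (invmx B)^T].
Proof.
move=> e; have BT : B^T \in unitmx by have [] := mulmx1_unit e.
have Bu : B \in unitmx by rewrite -unitmx_tr.
have BA : B *m A = (invmx B)^T.
  by rewrite -[LHS](mulmxK BT) e mul1mx trmx_inv.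
by split=> //; rewrite -BA mulKmx.
Qed.

Lemma frame_norm (A B : 'M[R]_n) (y : 'rV[R]_n) : B *m A *m B^T = 1%:M ->
  randers_norm A (l *m B *m A) y =
  Num.sqrt (dot (y *m invmx B) (y *m invmx B)) + dot l (y *m invmx B).
Proof.
move=> e; have [Bu AE BA] := frame_metric e.
rewrite /randers_norm /riem_norm -mulmxA BA [X in _ + X]dot_mulmx trmxK.
by rewrite {1}AE mulmxA dot_mulmx trmxK.
Qed.

Let orth0 : B0 *m A0 *m B0^T = 1%:M.
Proof. exact: nbhs_singleton orth. Qed.

Lemma frame_posdef : posdef A0.
Proof.
have [Bu -> _] := frame_metric orth0.
rewrite -[X in X *m _]mulmx1; apply: posdef_conj; first by rewrite unitmx_inv.
split; first exact: trmx1.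
by move=> v v0; rewrite mulmx1 dotvv_gt0.
Qed.

Lemma frame_Fpos z : z != 0 -> 0 < randers_norm A0 b0 z.
Proof.
move=> z0; have [Bu _ _] := frame_metric orth0.
rewrite /b0 /bf frame_norm //; set w := z *m _.
have w0 : w != 0.
  by apply: contra z0 => /eqP w0; rewrite -(mulmxKV Bu z) -/w w0 mul0mx.
have := cauchy_schwarz l w; have := dotvv_gt0 w0; have := l_lt1.
have := sqr_sqrtr (dotvv_ge0 w); have : 0 < Num.sqrt (dot w w).
  by rewrite sqrtr_gt0 dotvv_gt0.
set s := Num.sqrt _; set d := dot l w; set ll := dot l l; set ww := dot w w.
move=> s0 sE ll1 ww0 dd; rewrite ltNge; apply/negP => sd.
have : ll * ww < ww by rewrite gtr_pMl.
by nra.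
Qed.

(** The frame turns every unit ball into the same one, and the determinant of
    the change of coordinates is [sqrt (\det (Af u))]. *)
Lemma frame_density : exists2 K : R, 0 < K &
  \forall u \near u0, bh_density F c u = K * Num.sqrt (\det (Af u)).
Proof.
have [k k0 kE] := vol_randers_ball l_lt1.
have [q q0 qE] := vol_ellipsoid R n.
have pos1 : posdef (1%:M : 'M[R]_n).
  by split; [exact: trmx1|move=> v v0; rewrite mulmx1 dotvv_gt0].
have ballE : vol [set y : 'rV[R]_n | \sum_i y 0 i ^+ 2 < 1] = q%:E.
  have [_] := qE 1%:M 0 1 pos1.
  rewrite det1 sqrtr1 divr1 /halfpow ltr01 sqrtr1 expr1n !mulr1 => <-.
  congr vol; apply/funext => y /=; rewrite subr0 mulmx1 dotE.
  by under eq_bigr do rewrite expr2.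
exists (q / k); first exact: divr_gt0.
apply: filterS orth => u e; have [Bu AE _] := frame_metric e.
have dM0 : \det (invmx (Bf u)) != 0.
  by rewrite -unitfE -unitmxE unitmx_inv.
rewrite /bh_density ballE.
have -> : [set y | F c (cinv c u) y < 1] =
  [set y | Num.sqrt (dot (y *m invmx (Bf u)) (y *m invmx (Bf u)))
           + dot l (y *m invmx (Bf u)) < 1].
  by apply/funext => y /=; rewrite FE frame_norm.
rewrite kE ?unitmx_inv // [in RHS]AE det_mulmx det_tr -expr2 sqrtr_sqr /=.
by rewrite invf_div mulrA mulrAC.
Qed.

Let db : 'M[R]_n := \matrix_k (l *m (dB k *m A0 + B0 *m dA k)).

Lemma frame_derb k j : is_derive u0 (delta_mx 0 k) (fun u => bf u 0 j) (db k j).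
Proof.
rewrite mxE; under [X in is_derive _ _ X _]eq_fun do rewrite /bf -mulmxA.
have Hl i' j' := is_derive_cstfun (l i' j') u0 (delta_mx 0 k).
apply: (is_derive_eq (is_derive_mulmx (dP := 0) _ (is_derive_mulmx (derB k) (derA k)) 0 j)).
  by move=> i' j'; rewrite mxE; exact: Hl.
by rewrite mul0mx add0r.
Qed.

(** The derivative of the constant [dot v w], the inner product of two frame
    combinations with constant coefficients. *)
Lemma frame_orth_derive k (v w : 'rV[R]_n) :
  dot (v *m dB k *m A0) (w *m B0) + dot (v *m B0 *m dA k) (w *m B0)
  + dot (v *m B0 *m A0) (w *m dB k) = 0.
Proof.
have derBT i j : is_derive u0 (delta_mx 0 k) (fun u => (Bf u)^T i j) ((dB k)^T i j).
  by rewrite mxE; under [X in is_derive _ _ X _]eq_fun do rewrite mxE.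
have H := is_derive_mulmx (is_derive_mulmx (derB k) (derA k)) derBT.
have D : (dB k *m A0 + B0 *m dA k) *m B0^T + (B0 *m A0) *m (dB k)^T = 0.
  apply/matrixP => i j; rewrite [RHS]mxE.
  have := near_eq_is_derive (g := fun=> (1%:M : 'M[R]_n) i j) _ (H i j).
  case=> [|_ <-]; first by apply: filterS orth => u ->.
  exact: derive_val.
transitivity (dot (v *m ((dB k *m A0 + B0 *m dA k) *m B0^T + (B0 *m A0) *m (dB k)^T)) w).
  have dotT (p q : 'rV[R]_n) (N : 'M[R]_n) : dot p (q *m N) = dot (p *m N^T) q.
    by rewrite dot_mulmx trmxK.
  by rewrite !dotT -!dotDl mulmxDr mulmxDl mulmxDr !mulmxA.
by rewrite D mulmx0 /dot mul0mx mxE.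
Qed.

Lemma scale_mulmx_sum (v w : 'rV[R]_n) (N : 'M[R]_n) (k : 'I_n) :
  (v *m B0) 0 k *: (w *m N) =
  \sum_i \sum_j (v 0 i * w 0 j) *: (B0 i k *: row j N).
Proof.
rewrite mxE mulmx_sum_row scaler_suml; apply: eq_bigr => i _.
rewrite scaler_sumr; apply: eq_bigr => j _.
by rewrite !scalerA mulrAC.
Qed.

Lemma frame_bracket (v w : 'rV[R]_n) :
  \sum_k ((v *m B0) 0 k *: (w *m dB k) - (w *m B0) 0 k *: (v *m dB k)) =
  (\sum_i \sum_j (v 0 i * w 0 j) *: C i j) *m B0.
Proof.
rewrite mulmx_suml; under [RHS]eq_bigr do rewrite mulmx_suml.
under [RHS]eq_bigr do under eq_bigr do rewrite -scalemxAl -brC scaler_sumr.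
under [RHS]eq_bigr do rewrite exchange_big.
rewrite [RHS]exchange_big; apply: eq_bigr => k _ /=.
rewrite !scale_mulmx_sum [X in _ - X]exchange_big /= -sumrB.
apply: eq_bigr => i _; rewrite -sumrB; apply: eq_bigr => j _.
by rewrite scalerBr [w 0 j * _]mulrC.
Qed.

Lemma dot_suml (I : finType) (f : I -> 'rV[R]_n) (y : 'rV[R]_n) :
  dot (\sum_i f i) y = \sum_i dot (f i) y.
Proof. by rewrite /dot mulmx_suml summxE. Qed.

Lemma dot_frame (v w : 'rV[R]_n) : dot (v *m B0 *m A0) (w *m B0) = dot v w.
Proof. by rewrite [LHS]dotC dot_mulmx [LHS]dotC -!mulmxA (mulmxA B0) orth0 mulmx1. Qed.

Lemma dot_mul_row (v w : 'rV[R]_n) (N : 'M[R]_n) :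
  dot (v *m N) w = \sum_k v 0 k * dot (row k N) w.
Proof.
by rewrite mulmx_sum_row dot_suml; apply: eq_bigr => k _; rewrite dotZl.
Qed.

(** Closedness of the one-form: since its values on the frame are constant, its
    exterior derivative on two frame fields is minus its value on their
    bracket. *)
Lemma frame_dbsym : db^T = db.
Proof.
have [Bu _ _] := frame_metric orth0.
have S (v w : 'rV[R]_n) : dot (v *m B0 *m db) (w *m B0) = dot (w *m B0 *m db) (v *m B0).
  have E (p q : 'rV[R]_n) : dot (p *m B0 *m db) (q *m B0) =
      - \sum_k (p *m B0) 0 k * dot (q *m dB k) b0.
    rewrite dot_mul_row -sumrN; apply: eq_bigr => k _; rewrite -mulrN; congr (_ * _).
    rewrite rowK mulmxDr !mulmxA dotDl [dot (q *m _) b0]dotC.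
    by apply/eqP; rewrite -addr_eq0; apply/eqP; exact: frame_orth_derive.
  apply/eqP; rewrite !E -subr_eq0 opprK addrC -sumrB; apply/eqP.
  have := congr1 (fun z => dot z b0) (frame_bracket w v).
  rewrite dot_suml /=; under eq_bigr do rewrite dotDl dotNl !dotZl.
  move=> ->; rewrite dotC dot_frame dotC dot_suml big1 // => i _.
  by rewrite dot_suml big1 // => j _; rewrite dotZl dotC lC mulr0.
apply/matrixP => i j; rewrite mxE.
have := S (delta_mx 0 j *m invmx B0) (delta_mx 0 i *m invmx B0).
by rewrite !mulmxKV // !dot_delta -!rowE ![row _ _ _ _]mxE.
Qed.

Hypothesis dAsym : forall k, (dA k)^T = dA k.

(** Here [y] is extended to the field with constant components [w].  The
    derivative of the metric is eliminated from [r00] by constancy of the inner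
    products of frame fields, and the bracket of this field with the dual of the
    one-form remains. *)
Lemma frame_r00 (w : 'rV[R]_n) :
  r00 A0 b0 dA db (w *m B0) = \sum_i \sum_j w 0 i * l 0 j * dot (C i j) w.
Proof.
have Apos := frame_posdef; have Au := posdef_unitmx Apos.
set y := w *m B0; pose xl := l *m B0.
have -> : \sum_i \sum_j w 0 i * l 0 j * dot (C i j) w =
    \sum_k (y 0 k * dot (l *m dB k *m A0) y - xl 0 k * dot (w *m dB k *m A0) y).
  transitivity (dot ((\sum_i \sum_j (w 0 i * l 0 j) *: C i j) *m B0 *m A0) y).
    rewrite dot_frame dot_suml; apply: eq_bigr => i _.
    by rewrite dot_suml; apply: eq_bigr => j _; rewrite dotZl.
  rewrite -frame_bracket mulmx_suml dot_suml; apply: eq_bigr => k _.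
  by rewrite mulmxBl -!scalemxAl dotDl dotNl !dotZl.
have covE : dot (riem_cov dA y) xl =
   \sum_k (2 * (y 0 k * dot (xl *m dA k) y) - xl 0 k * dot (y *m dA k) y).
  rewrite dotE; under eq_bigr do rewrite mxE mulrBl.
  rewrite sumrB [RHS]sumrB; congr (_ - _); last by apply: eq_bigr => k _; rewrite mulrC.
  under eq_bigr do rewrite -mulrA mulr_suml mulr_sumr.
  rewrite exchange_big /=; apply: eq_bigr => k _; rewrite -!mulr_sumr; congr (2 * _).
  under eq_bigr do rewrite -mulrA.
  rewrite -mulr_sumr; congr (_ * _); rewrite -dotE.
  by rewrite dot_mulmx dAsym dotC.
have -> : r00 A0 b0 dA db y = dot (y *m db) y - 2^-1 * dot (riem_cov dA y) xl.
  rewrite /r00 /riem_spray dotZr mulrA; congr (_ - _ * _); first by field.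
  rewrite dotC dot_mulmx trmx_inv Apos.1 /b0 /bf -/xl.
  by rewrite mulmxK.
rewrite covE dot_mul_row mulr_sumr -sumrB; apply: eq_bigr => k _.
rewrite rowK mulmxDr dotDl !mulmxA -/xl.
have := frame_orth_derive k w w; rewrite -/y.
have -> : dot (y *m A0) (w *m dB k) = dot (w *m dB k *m A0) y.
  by rewrite dotC [RHS]dot_mulmx Apos.1.
set p := dot (w *m dB k *m A0) y => /eqP; rewrite addrAC addrC addr_eq0 => /eqP ->.
by field.
Qed.

Theorem S_curvature_frame (w : 'rV[R]_n) : w != 0 ->
  S_curvature F c x (w *m B0) =
  n.+1%:R / 2 * ((\sum_i \sum_j w 0 i * l 0 j * dot (C i j) w) / F c (cinv c u0) (w *m B0)).
Proof.
move=> w0; have [Bu _ _] := frame_metric orth0.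
have [K K0 KE] := frame_density.
have wB0 : w *m B0 != 0.
  by apply: contra w0 => /eqP e; rewrite -(mulmxK Bu w) e mul0mx.
have sqFE u y : sqF F c u y = randers_norm (Af u) (bf u) y ^+ 2 by rewrite /sqF FE.
rewrite (S_curvature_randers sqFE derA frame_derb frame_posdef dAsym frame_dbsym
  frame_Fpos K0 KE wB0) frame_r00 FE.
by rewrite invfM; ring.
Qed.

End Frame.

(** * Left invariant Randers metrics *)

Lemma smooth_is_derive (R : realType) (n : nat) (U : set 'rV[R]_n)
    (f : 'rV[R]_n -> R) (u : 'rV[R]_n) (k : 'I_n) :
  smooth_on U f -> U u -> is_derive u (delta_mx 0 k) f (pderiv k f u).
Proof.
by move=> /(_ 1%N)[_ /(_ k)[df _]] Uu; apply: derivableP; exact: df.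
Qed.

Lemma bracket_antisym (R : realType) (M : Type) (n : nat)
    (V W : vector_field R M n) c x : bracket W V c x = - bracket V W c x.
Proof.
apply/rowP => i; rewrite !mxE -sumrN; apply: eq_bigr => j _.
by rewrite opprB.
Qed.

Lemma bracket_self (R : realType) (M : Type) (n : nat)
    (V : vector_field R M n) c x : bracket V V c x = 0.
Proof. by apply/rowP => i; rewrite !mxE big1 // => j _; rewrite subrr. Qed.

Section LeftInvariantRanders.
Context (R : realType) (G : groupTopologyType) (n : nat) (A : set (chart R G n)).
Context (m : bilinear_field R G n) (E : n.-tuple (vector_field R G n)).
Context (X : vector_field R G n) (l : 'rV[R]_n) (C : 'I_n -> 'I_n -> 'rV[R]_n).
Context (k : chart R G n).
Hypothesis G_lie : lie_group A.
Hypothesis m_riem : is_riemannian_metric A m.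
Hypothesis m_inv : left_invariant_metric A m.
Hypothesis E_lie : forall i, in_lie_algebra A (tnth E i).
Hypothesis E_orth : orthonormal_at A m 1%g E.
Hypothesis X_def : forall x, X k x = \sum_i l 0 i *: tnth E i k x.
Hypothesis X_lt1 : Num.sqrt (ip m k 1%g (X k 1%g) (X k 1%g)) < 1.
Hypothesis E_br : forall i j,
  bracket (tnth E i) (tnth E j) k 1%g = \sum_q C i j 0 q *: tnth E q k 1%g.
Hypothesis lC : forall i j, dot l (C i j) = 0.
Hypothesis Ak : A k.
Hypothesis k1 : cdom k 1%g.

Let u0 := cmap k 1%g.
Let Af u : 'M[R]_n := m k (cinv k u).
Let Bf u : 'M[R]_n := \matrix_i tnth E i k (cinv k u).
Let dA p : 'M[R]_n := \matrix_(i, j) pderiv p (fun u => Af u i j) u0.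
Let dB p : 'M[R]_n := \matrix_(i, j) pderiv p (fun u => Bf u i j) u0.

Let k_chart : is_chart k.
Proof. by have [[_ _ H _] _ _ _ _] := G_lie; exact: H. Qed.

Let cinv_cimg u : cimg k u -> cdom k (cinv k u).
Proof. by have [_ _ H _ _] := k_chart; case=> x kx <-; rewrite H. Qed.

Let u0_cimg : cimg k u0.
Proof. by exists 1%g. Qed.

Let cinv_u0 : cinv k u0 = 1%g.
Proof. by have [_ _ H _ _] := k_chart; rewrite H. Qed.

Let near_cimg : \forall u \near u0, cimg k u.
Proof.
by apply: open_nbhs_nbhs; split; [have [] := k_chart|exact: u0_cimg].
Qed.

(** Left translation from the unit preserves both the frame and the metric. *)
Lemma frame_orthonormal u : cimg k u -> Bf u *m Af u *m (Bf u)^T = 1%:M.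
Proof.
move=> /cinv_cimg; set x := cinv k u => kx.
have kx1 : cdom k (x * 1)%g by rewrite mulg1.
apply/matrixP => i j; rewrite [RHS]mxE -(E_orth Ak k1).
rewrite -(m_inv _ _ Ak Ak k1 kx1).
have [[_ /(_ x 1%g k k Ak Ak k1 kx1) <-] [_ /(_ x 1%g k k Ak Ak k1 kx1) <-]] :=
  (E_lie i, E_lie j).
have rE p : tnth E p k x = row p (Bf u) by rewrite rowK.
rewrite mulg1 /ip !rE -row_mul [LHS]mxE [RHS]mxE; apply: eq_bigr => q _.
by rewrite [row i _ _ _]mxE; congr (_ * _); rewrite [LHS]mxE 2![in RHS]mxE.
Qed.

(** The sum is [<[Y, X], Y>].  The hypothesis [lC] on [X], orthogonality to the
    derived algebra, is what makes the dual one-form closed. *)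
Theorem S_curvature_left_invariant (w : 'rV[R]_n) :
  let Y := \sum_i w 0 i *: tnth E i k 1%g in
  Y != 0 ->
  S_curvature (randers m X) k 1%g Y =
  n.+1%:R / 2 * ((\sum_i \sum_j w 0 i * l 0 j * dot (C i j) w) / randers m X k 1%g Y).
Proof.
have lB (v : 'rV[R]_n) u : \sum_i v 0 i *: tnth E i k (cinv k u) = v *m Bf u.
  by rewrite mulmx_sum_row; apply: eq_bigr => i _; rewrite rowK.
have lB0 (v : 'rV[R]_n) : \sum_i v 0 i *: tnth E i k 1%g = v *m Bf u0.
  by rewrite -lB cinv_u0.
rewrite lB0 /= => Y0.
have w0 : w != 0 by apply: contra Y0 => /eqP ->; rewrite mul0mx.
have FE u y : randers m X k (cinv k u) y = randers_norm (Af u) (l *m Bf u *m Af u) y.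
  by rewrite /randers /ip X_def lB.
have [_ m_sym _ m_smooth] := m_riem.
have derA p i j : is_derive u0 (delta_mx 0 p) (fun u => Af u i j) (dA p i j).
  by rewrite mxE; apply: smooth_is_derive u0_cimg; exact: m_smooth.
have derB p i j : is_derive u0 (delta_mx 0 p) (fun u => Bf u i j) (dB p i j).
  rewrite mxE; apply: smooth_is_derive u0_cimg.
  have [[_ /(_ k Ak) sm] _] := E_lie i.
  by rewrite (_ : (fun u => Bf u i j) = fun u => tnth E i k (cinv k u) 0 j) //;
    apply/funext => u; rewrite mxE.
have orth : \forall u \near u0, Bf u *m Af u *m (Bf u)^T = 1%:M.
  by apply: filterS near_cimg => u; exact: frame_orthonormal.
have Asym u : cimg k u -> (Af u)^T = Af u.
  move=> /cinv_cimg kx; apply/matrixP => i j; rewrite mxE.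
  have := m_sym k (cinv k u) (delta_mx 0 i) (delta_mx 0 j) Ak kx.
  by rewrite -[LHS]/(dot _ _) -[RHS]/(dot _ _) !dot_delta -!rowE !mxE.
have dAsym p : (dA p)^T = dA p.
  apply/matrixP => i j; rewrite !mxE; apply: near_eq_derive.
  by apply: filterS near_cimg => u /Asym e; rewrite -[in LHS]e mxE.
have l1 : dot l l < 1.
  have m1 : m k 1%g = Af u0 by rewrite /Af cinv_u0.
  have := X_lt1; rewrite X_def lB0 /ip m1 -/(dot _ _).
  by rewrite (dot_frame orth) -[X in _ < X]sqrtr1 ltr_sqrt.
have brC i j : \sum_p (Bf u0 i p *: row j (dB p) - Bf u0 j p *: row i (dB p)) =
               C i j *m Bf u0.
  rewrite -lB0 -E_br; apply/rowP => q; rewrite summxE mxE; apply: eq_bigr => p _.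
  have B0E r : Bf u0 r p = tnth E r k 1%g 0 p by rewrite mxE cinv_u0.
  have dBE r : dB p r q = pderiv p (fun u => tnth E r k (cinv k u) 0 q) u0.
    by rewrite mxE; congr pderiv; apply/funext => u; rewrite mxE.
  have combE (r s : R) (P Q : 'rV[R]_n) :
      (r *: P - s *: Q) 0 q = r * P 0 q - s * Q 0 q by rewrite !mxE.
  by rewrite combE ![row _ _ 0 q]mxE !B0E !dBE.
by rewrite (S_curvature_frame FE derA derB orth l1 brC lC dAsym w0) cinv_u0.
Qed.

End LeftInvariantRanders.

(** * The algebra l_{5,6} *)

(** Components of the brackets [[E_(i+1), E_(j+1)]] for [i < j]; the table is
    zero elsewhere, to be antisymmetrized by subtracting its transpose. *)
Definition l56_structure (R : realType) (a b c d f g h : R) (i j : nat) : seq R :=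
  match i, j with
  | 0, 1 => [:: 0; 0; a; b; c]
  | 0, 2 => [:: 0; 0; 0; d; f]
  | 0, 3 => [:: 0; 0; 0; 0; g]
  | 1, 2 => [:: 0; 0; 0; 0; h]
  | _, _ => [::]
  end.

Theorem theorem3p8 (R : realType) (G : groupTopologyType)
    (A : set (chart R G 5)) (m : bilinear_field R G 5)
    (E1 E2 E3 E4 E5 X : vector_field R G 5) (F : tangent_function R G 5)
    (a b c d f g h l1 l2 : R)
    (G_lie : lie_group A)
    (G_sc : simply_connected R G)
    (G_nil : nilpotent_group G)
    (m_riem : is_riemannian_metric A m)
    (m_inv : left_invariant_metric A m)
    (E_lie : [/\ in_lie_algebra A E1, in_lie_algebra A E2,
                 in_lie_algebra A E3, in_lie_algebra A E4 &
                 in_lie_algebra A E5])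
    (E_orth : orthonormal_at A m 1%g [tuple E1; E2; E3; E4; E5])
    (E_br : l56_brackets A a b c d f g h E1 E2 E3 E4 E5)
    (a_gt0 : 0 < a) (d_gt0 : 0 < d) (g_gt0 : 0 < g) (h_gt0 : 0 < h)
    (bf : 0 < b \/ (b = 0 /\ 0 <= f))
    (X_def : X = l1 *: E1 + l2 *: E2)
    (X_lt1 : forall k x, A k -> cdom k x ->
       Num.sqrt (ip m k x (X k x) (X k x)) < 1)
    (F_def : F = randers m X)
    (F_inv : left_invariant_finsler A F)
    (F_nonriem : ~ is_riemannian A F)
    (F_douglas : douglas A F) :
  forall (k : chart R G 5), A k -> cdom k 1%g ->
  forall y1 y2 y3 y4 y5 : R,
  let Y := (y1 *: E1 + y2 *: E2 + y3 *: E3 + y4 *: E4 + y5 *: E5) k 1%g in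
  Y != 0 ->
  S_curvature F k 1%g Y =
  3 * (((y1 * l2 - y2 * l1) * (a * y3 + b * y4 + c * y5)
        - l1 * y3 * (d * y4 + f * y5)
        - y5 * (h * l2 * y3 + g * l1 * y4)) / F k 1%g Y).
Proof.
move=> k Ak k1 y1 y2 y3 y4 y5 Y Y0.
pose E := [tuple E1; E2; E3; E4; E5].
pose t (i j q : nat) : R := (l56_structure a b c d f g h i j)`_q.
pose C (i j : 'I_5) : 'rV[R]_5 := \row_(q < 5) (t i j q - t j i q).
pose l : 'rV[R]_5 := \row_(q < 5) [:: l1; l2]`_q.
pose w : 'rV[R]_5 := \row_(q < 5) [:: y1; y2; y3; y4; y5]`_q.
have sum_frame (s : nat -> R) (x : G) : \sum_i (\row_(q < 5) s q) 0 i *: tnth E i k x =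
    s 0 *: E1 k x + s 1 *: E2 k x + s 2 *: E3 k x + s 3 *: E4 k x + s 4 *: E5 k x.
  by rewrite 5!big_ord_recl big_ord0 addr0 !addrA !mxE.
have E_lie' i : in_lie_algebra A (tnth E i).
  by case: E_lie; case: i => -[|[|[|[|[|]]]]].
have X_def' x : X k x = \sum_i l 0 i *: tnth E i k x.
  by rewrite (sum_frame (fun q => [:: l1; l2]`_q)) /= !scale0r !addr0 X_def.
have E_br' i j : bracket (tnth E i) (tnth E j) k 1%g =
                 \sum_q C i j 0 q *: tnth E q k 1%g.
  have antisym p q : \sum_r C p q 0 r *: tnth E r k 1%g =
                     - \sum_r C q p 0 r *: tnth E r k 1%g.
    by rewrite -sumrN; apply: eq_bigr => r _; rewrite -scaleNr !mxE opprB.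
  wlog ij : i j / (i < j)%N => [W|].
    have [ij|ji|/val_inj ->] := ltngtP i j; first exact: W.
      by rewrite bracket_antisym antisym W.
    by rewrite bracket_self big1 // => r _; rewrite mxE subrr scale0r.
  case: E_br => B12 B13 B14 B23 [B15 B24 B25 [B34 B35 B45]].
  rewrite (sum_frame (fun q => t i j q - t j i q)) /t.
  (* each of the ten cases is, up to conversion, one of the bracket relations *)
  case: i j ij => -[|[|[|[|[|]]]]] // i5 [[|[|[|[|[|]]]]]] // j5 _;
    rewrite /= !subr0 !scale0r ?add0r ?addr0;
    first [exact: (B12 _ _ Ak k1) | exact: (B13 _ _ Ak k1) | exact: (B14 _ _ Ak k1)
      | exact: (B23 _ _ Ak k1) | exact: (B15 _ _ Ak k1) | exact: (B24 _ _ Ak k1)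
      | exact: (B25 _ _ Ak k1) | exact: (B34 _ _ Ak k1) | exact: (B35 _ _ Ak k1)
      | exact: (B45 _ _ Ak k1)].
have lC i j : dot l (C i j) = 0.
  (* no bracket has a component along E1 or E2, and X has no other ones *)
  have t0 p q : t p q 0 = 0 by case: p => [|[|p]]; case: q => [|[|[|[|q]]]].
  have t1 p q : t p q 1 = 0 by case: p => [|[|p]]; case: q => [|[|[|[|q]]]].
  rewrite dotE 5!big_ord_recl big_ord0 !mxE /= !t0 !t1 !subr0.
  by ring.
have YE : Y = \sum_i w 0 i *: tnth E i k 1%g.
  by rewrite (sum_frame (fun q => [:: y1; y2; y3; y4; y5]`_q)).
have X_lt1' := X_lt1 k 1%g Ak k1.
rewrite F_def YE (S_curvature_left_invariant G_lie m_riem m_inv E_lie' E_orth X_def'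
  X_lt1' E_br' lC Ak k1) -?YE //.
have dC i j : dot (C i j) w =
    (t i j 0 - t j i 0) * y1 + (t i j 1 - t j i 1) * y2 + (t i j 2 - t j i 2) * y3
    + (t i j 3 - t j i 3) * y4 + (t i j 4 - t j i 4) * y5.
  by rewrite dotE 5!big_ord_recl big_ord0 !mxE /= addr0 !addrA.
congr (_ * (_ / _)); first by field.
have lsum i : \sum_j w 0 i * l 0 j * dot (C i j) w =
    w 0 i * (l1 * dot (C i 0) w + l2 * dot (C i 1) w).
  rewrite 2!big_ord_recl big1 ?addr0 => [|j _]; last first.
    by rewrite [l 0 _]mxE nth_default // mulr0 mul0r.
  have -> : lift 0 0 = 1 :> 'I_5 by exact: val_inj.
  by rewrite ![l 0 _]mxE /=; ring.
under eq_bigr do rewrite lsum !dC.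
rewrite 5!big_ord_recl big_ord0 ![w 0 _]mxE /t /=.
by ring.
Qed.
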